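(* Suppose that the boundary is impermeable, i.e. $\boldsymbol{\beta}\cdot\mathbf{n}=0$ on $\partial\Omega$, that $\boldsymbol{\beta}$ is divergence-free, and that the normal component of $\boldsymbol{\beta}$ is continuous across each interior edge of the mesh. Then the scheme $$U^{n+1}=(I-\Delta t^n M^{-1}S^n)U^n,\qquad n\ge 0,$$ with arbitrary initial vector $U^0\in\mathbb{R}^N$ and $u_h^n=\sum_{i=1}^N U_i^n\varphi_i$, is conservative, i.e. $$\int_\Omega u_h^n\,\mathrm{d}\mathbf{x}=\int_\Omega u_h^0\,\mathrm{d}\mathbf{x}\qquad\text{for all } n\ge 0 .$$
   Context: Mesh and space. $\Omega\subset\mathbb{R}^2$ is an open (bounded) polygonal domain with outward unit normal $\mathbf{n}$, and $\mathcal{K}_h$ is a triangulation of $\Omega$ without hanging nodes. $\mathcal{F}_h$ is the set of edges, $\mathcal{F}_h^{\mathrm{int}}$ the set of interior edges, and $\mathbf{x}_1,\dots,\mathbf{x}_N$ are the midpoints of all edges. For each edge $F$ a unit normal $\mathbf{n}_F$ is fixed; for a piecewise polynomial $v$ and $\mathbf{x}\in F\in\mathcal{F}_h^{\mathrm{int}}$ put $v^{\mp}(\mathbf{x})=\lim_{\epsilon\to0^+}v(\mathbf{x}\mp\epsilon\mathbf{n}_F)$ and $[\![v]\!]=v^+-v^-$. The Crouzeix-Raviart space $\mathcal{V}_h$ is the set of functions $v_h$ that are affine on each triangle and satisfy $\int_F[\![v_h]\!]\,\mathrm{d}s=0$ for all $F\in\mathcal{F}_h^{\mathrm{int}}$.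 Its basis $\varphi_1,\dots,\varphi_N$ is determined by $\varphi_i(\mathbf{x}_j)=\delta_{ij}$. $S_i$ is the support of $\varphi_i$. The mass matrix is diagonal: $M=\mathrm{diag}(m_1,\dots,m_N)$ with $m_i=\frac13|S_i|$. Velocity. $\boldsymbol{\beta}$ is a bounded velocity field, possibly time-dependent; at time level $n$ it is evaluated at $t=t^n$. It is understood to be regular enough to have traces on the triangle boundaries and to satisfy the divergence theorem on each triangle (against affine functions). Forms (at time $t^n$), where on $\partial K$ the vector $\mathbf{n}$ is the unit normal outward to $K$ and functions on $\partial K$ are traces from inside $K$: $$a_h(u_h,v_h)=\sum_{K\in\mathcal{K}_h}\int_K(\boldsymbol{\beta}\cdot\nabla u_h)\,v_h\,\mathrm{d}\mathbf{x},$$ $$b_h(u_h,v_h)=\sum_{K\in\mathcal{K}_h}\int_{\partial K\setminus\partial\Omega}\boldsymbol{\beta}\cdot\mathbf{n}\,u_hv_h\,\mathrm{d}s-\sum_{F\in\mathcal{F}_h^{\mathrm{int}}}\int_F\mathrm{Up}(u_h,\boldsymbol{\beta})\,(-[\![v_h]\!])\,\mathrm{d}s,$$ $$\mathrm{Up}(u_h,\boldsymbol{\beta})|_F=u_h^-\max(0,\boldsymbol{\beta}\cdot\mathbf{n}_F)+u_h^+\min(0,\boldsymbol{\beta}\cdot\mathbf{n}_F).$$ The matrix $S^n=(s_{ij}^n)$ is defined by $s_{ij}^n=a_h(\varphi_j,\varphi_i)-b_h(\varphi_j,\varphi_i)$. The time steps $\Delta t^n=t^{n+1}-t^n>0$ are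 arbitrary. *)

(* Defs.v *)
From HB Require Import structures.
From mathcomp Require Import all_boot all_order all_algebra.
From mathcomp Require Import all_classical all_reals all_analysis.

Set Implicit Arguments.
Unset Strict Implicit.
Unset Printing Implicit Defensive.

Import Order.TTheory GRing.Theory Num.Theory.
Import numFieldNormedType.Exports.

Local Open Scope classical_set_scope.
Local Open Scope ring_scope.

(* The plane is R * R with the product of two Lebesgue measures.  Its library
   norm is the max norm, hence the Euclidean dot and enorm below. *)

Definition mu2 (R : realType) := (@lebesgue_measure R \x @lebesgue_measure R)%E.

Definition dot (R : realType) (u v : R * R) : R := u.1 * v.1 + u.2 * v.2.

Definition enorm (R : realType) (u : R * R) : R := Num.sqrt (dot u u).

(* An edge is given by its two endpoints; their order is irrelevant. *)
Definition same_edge (R : realType) (e e' : (R * R) * (R * R)) : Prop :=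
  e = e' \/ e = (e'.2, e'.1).

Definition edge_pt (R : realType) (e : (R * R) * (R * R)) (s : R) : R * R :=
  (1 - s) *: e.1 + s *: e.2.

Definition edge_set (R : realType) (e : (R * R) * (R * R)) : set (R * R) :=
  [set edge_pt e s | s in `[0, 1]%classic].

Definition midpoint (R : realType) (e : (R * R) * (R * R)) : R * R :=
  edge_pt e (2^-1).

(* Arc-length integral of g over the part of the edge e lying in A. *)
Definition edge_int (R : realType) (A : set (R * R)) (e : (R * R) * (R * R))
    (g : R * R -> R) : R :=
  enorm (e.2 - e.1) *
  (\int[@lebesgue_measure R]_(s in [set s | s \in `[0, 1] /\ A (edge_pt e s)])
     g (edge_pt e s))%R.

(* "Almost every point of e" (with respect to arc length) satisfies P. *)
Definition ae_edge (R : realType) (e : (R * R) * (R * R))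
    (P : R * R -> Prop) : Prop :=
  {ae @lebesgue_measure R, forall s : R, s \in `[0, 1] -> P (edge_pt e s)}.

Definition frontier (R : realType) (A : set (R * R)) : set (R * R) :=
  closure A `\` A°.

(* The condition Omega = int (closure Omega) excludes slits, for which there
   is no outward normal. *)
Record polygonal_domain (R : realType) (Omega : set (R * R)) : Prop := {
  pd_open : open Omega;
  pd_nonempty : Omega !=set0;
  pd_connected : connected Omega;
  pd_bounded : bounded_set Omega;
  pd_no_slit : Omega = (closure Omega)°;
  pd_polygonal : exists l : seq ((R * R) * (R * R)),
    frontier Omega = [set x | exists2 e, e \in l & edge_set e x] }.

Definition triangle (R : realType) (p : 'I_3 -> R * R) : set (R * R) :=
  [set x | exists l : 'I_3 -> R,
     [/\ forall k, 0 <= l k, \sum_k l k = 1 & x = \sum_k l k *: p k]].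

(* The k-th side is the one opposite to the k-th vertex (indices mod 3). *)
Definition side (R : realType) (p : 'I_3 -> R * R) (k : 'I_3) :
    (R * R) * (R * R) := (p (k + 1), p (k + 2)).

(* Twice the signed area. *)
Definition orient (R : realType) (p : 'I_3 -> R * R) : R :=
  let a := p 1 - p 0 in let b := p 2 - p 0 in a.1 * b.2 - a.2 * b.1.

(* Unit normal to the k-th side, pointing out of the triangle: a side run
   counterclockwise has its outward normal on the right. *)
Definition outnormal (R : realType) (p : 'I_3 -> R * R) (k : 'I_3) : R * R :=
  let d := (side p k).2 - (side p k).1 in
  (Num.sg (orient p) / enorm d) *: ((d.2, - d.1) : R * R).

Record triangulation (R : realType) (Omega : set (R * R)) := Triangulation {
  ntri : nat;
  vtx : 'I_ntri -> 'I_3 -> R * R;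
  nedge : nat;
  edge : 'I_nedge -> (R * R) * (R * R);
  nF : 'I_nedge -> R * R;
  tri_nondegenerate : forall K, orient (vtx K) != 0;
  tri_cover : closure Omega = \bigcup_K triangle (vtx K);
  (* no hanging nodes *)
  tri_conform : forall K L, K != L ->
    let I := triangle (vtx K) `&` triangle (vtx L) in
    [\/ I = set0,
        exists k l, vtx K k = vtx L l /\ I = [set vtx K k] |
        exists k l, same_edge (side (vtx K) k) (side (vtx L) l) /\
                    I = edge_set (side (vtx K) k)];
  (* the edges are exactly the sides of the triangles, listed once *)
  edge_inj : forall i j, same_edge (edge i) (edge j) -> i = j;
  edge_side : forall i, exists K k, same_edge (edge i) (side (vtx K) k);
  side_edge : forall K k, exists i, same_edge (edge i) (side (vtx K) k);
  nF_unit : forall i, enorm (nF i) = 1;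
  nF_normal : forall i, dot (nF i) ((edge i).2 - (edge i).1) = 0 }.

Section Mesh.
Variables (R : realType) (Omega : set (R * R)) (T : triangulation Omega).

Implicit Types (beta : R * R -> R * R).

Definition interior_edge (i : 'I_(nedge T)) : Prop :=
  exists K L k l, [/\ K != L,
    same_edge (edge i) (side (vtx (t := T) K) k) &
    same_edge (edge i) (side (vtx (t := T) L) l)].

(* The open triangle; integrals over a triangle are taken over it. *)
Definition otri (K : 'I_(ntri T)) : set (R * R) := (triangle (vtx K))°.

(* One-sided limit at x along the direction n, from the side opposite to n. *)
Definition trace (V : normedModType R) (f : R * R -> V) (x n : R * R) : V :=
  lim (f (x - e *: n) @[e --> 0^'+]).

Definition has_trace (V : normedModType R) (f : R * R -> V) (x n : R * R) :=
  cvg (f (x - e *: n) @[e --> 0^'+]).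

(* Integral over the part of the boundary of K lying in A; the integrand
   receives the point and the unit normal outward to K. *)
Definition bnd_int (A : set (R * R)) (K : 'I_(ntri T))
    (g : R * R -> R * R -> R) : R :=
  \sum_(k < 3) edge_int A (side (vtx K) k) (fun x => g x (outnormal (vtx K) k)).

(* A pair (c, g) encodes the affine function x |-> c + g . x, of gradient g.
   A broken function is one affine function per triangle; as its values on the
   edges are two-valued, broken_fun realizes it inside the triangles only. *)
Definition aff (q : R * (R * R)) (x : R * R) : R := q.1 + dot q.2 x.

Definition broken := 'I_(ntri T) -> R * (R * R).

Definition broken_fun (v : broken) (x : R * R) : R :=
  \sum_K aff (v K) x * \1_(otri K) x.

Definition jump (v : broken) (n x : R * R) : R :=
  trace (broken_fun v) x (- n) - trace (broken_fun v) x n.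

Definition CR_space (v : broken) : Prop :=
  forall i, interior_edge i -> edge_int setT (edge i) (jump v (nF i)) = 0.

(* The nodal values are taken from inside each triangle having the edge as a
   side. *)
Definition CR_basis (phi : 'I_(nedge T) -> broken) : Prop :=
  (forall i, CR_space (phi i)) /\
  (forall i j K k, same_edge (edge j) (side (vtx K) k) ->
     aff (phi i K) (midpoint (edge j)) = (i == j)%:R).

Definition CR_support (v : broken) : set (R * R) :=
  closure [set x | broken_fun v x != 0].

Definition mass (phi : 'I_(nedge T) -> broken) : 'M[R]_(nedge T) :=
  diag_mx (\row_i (3^-1 * fine (mu2 (CR_support (phi i))))).

Definition a_h beta (u v : broken) : R :=
  \sum_K (\int[@mu2 R]_(x in otri K) (dot (beta x) (u K).2 * aff (v K) x))%R.

(* The normal component of beta on F is taken from the minus side; both sides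
   agree when it is continuous across F. *)
Definition upwind beta (u : broken) (n x : R * R) : R :=
  let bn := dot (trace beta x n) n in
  trace (broken_fun u) x n * Num.max 0 bn +
  trace (broken_fun u) x (- n) * Num.min 0 bn.

Definition b_h beta (u v : broken) : R :=
  \sum_K bnd_int (~` frontier Omega) K
    (fun x n => dot (trace beta x n) n * aff (u K) x * aff (v K) x) -
  \sum_(i < nedge T | `[< interior_edge i >])
    edge_int setT (edge i)
      (fun x => upwind beta u (nF i) x * (- jump v (nF i) x)).

Definition stiffness beta (phi : 'I_(nedge T) -> broken) : 'M[R]_(nedge T) :=
  \matrix_(i, j) (a_h beta (phi j) (phi i) - b_h beta (phi j) (phi i)).

Definition grad (psi : R * R -> R) (x : R * R) : R * R :=
  ('D_((1, 0) : R * R) psi x, 'D_((0, 1) : R * R) psi x).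

Definition test_function (A : set (R * R)) (psi : R * R -> R) : Prop :=
  [/\ forall x, derivable psi x (1, 0) /\ derivable psi x (0, 1),
      continuous psi, continuous (grad psi),
      compact (closure [set x | psi x != 0]) &
      closure [set x | psi x != 0] `<=` A].

(* d is the divergence of beta on A in the sense of distributions *)
Definition is_div (A : set (R * R)) beta (d : R * R -> R) : Prop :=
  forall psi, test_function A psi ->
    (\int[@mu2 R]_(x in A) (dot (beta x) (grad psi x) + d x * psi x))%R = 0.

Record regular_velocity beta : Prop := {
  rv_measurable : measurable_fun Omega beta;
  rv_bounded : exists C, forall x, Omega x -> enorm (beta x) <= C;
  rv_trace : forall K k,
    ae_edge (side (vtx (t := T) K) k) (fun x =>
      has_trace beta x (outnormal (vtx K) k));
  rv_trace_measurable : forall K k,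
    measurable_fun (`[0, 1]%classic : set R) (fun s =>
      trace beta (edge_pt (side (vtx (t := T) K) k) s) (outnormal (vtx K) k));
  (* divergence theorem on each triangle, against affine functions *)
  rv_divergence : forall K (d : R * R -> R),
    (@mu2 R).-integrable (otri K) (fun x => (d x)%:E) ->
    is_div (otri K) beta d -> forall q,
    (\int[@mu2 R]_(x in otri K) (dot (beta x) q.2 + d x * aff q x))%R =
    bnd_int setT K (fun x n => dot (trace beta x n) n * aff q x) }.

(* The outward normal to Omega on a side contained in its boundary is the
   outward normal to the triangle. *)
Definition impermeable beta : Prop :=
  forall K k, ae_edge (side (vtx (t := T) K) k) (fun x => frontier Omega x ->
    dot (trace beta x (outnormal (vtx K) k)) (outnormal (vtx K) k) = 0).

(* Triangle by triangle: together with the continuity of the normal component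
   this amounts to a vanishing divergence in Omega. *)
Definition divergence_free beta : Prop :=
  forall K : 'I_(ntri T), is_div (otri K) beta (fun=> 0).

Definition normal_continuous beta : Prop :=
  forall i, interior_edge i -> ae_edge (edge i) (fun x =>
    dot (trace beta x (nF i)) (nF i) = dot (trace beta x (- nF i)) (nF i)).

End Mesh.

(* Main.v *)
Require Import Defs.
From HB Require Import structures.
From mathcomp Require Import all_boot all_order all_algebra.
From mathcomp Require Import all_classical all_reals all_analysis.
From mathcomp Require Import measurable_realfun ring lra.

Set Implicit Arguments.
Unset Strict Implicit.
Unset Printing Implicit Defensive.

Import Order.TTheory GRing.Theory Num.Theory.
Import numFieldNormedType.Exports.

Local Open Scope classical_set_scope.
Local Open Scope ring_scope.

(** The integral of a discrete function is a linear form of its nodal vector: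
    since the basis functions take the values 0 and 1 at the edge midpoints and
    the integral of an affine function over a triangle is the area times the
    mean of its values at the three midpoints, the integral of the basis
    function of edge i is one third of the area of the triangles having i as a
    side, that is, the mass m_i ([mass_entry_int]).  So the integral of u is
    the sum of the entries of M U ([total_massE]), and one step of the scheme
    changes it by minus dt times the sum of the entries of S U, as M is
    invertible ([mass_unit]).  It remains to see that the columns of S sum to
    zero ([stiffness_colsum]).

    The basis functions sum to 1 on each triangle ([sum_phi]), because an
    affine function is determined by its values at the three midpoints.  So
    a column sum of S is a_h(u, 1) - b_h(u, 1), where u is the basis function
    of the column.  On each triangle K the divergence theorem turns the integral
    of beta . grad u over K into the integral of (beta . n) u over the boundary
    of K ([sum_a_h]); impermeability removes the part of it that lies on the
    boundary of the domain, and what is left is the first sum of b_h(u, 1).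
    The second sum of b_h(u, 1) vanishes because the constant 1 has no
    jumps ([sum_upwind_eq0], [sum_b_h]).

    Two points take some work.  The midpoint rule needs the three barycentric
    coordinates to have the same integral over the triangle; they are permuted
    by the affine map that permutes the vertices cyclically, and this map
    preserves the plane measure because it is a product of three shears
    ([vtx_rot_shear]), each of which translates the lines parallel to an axis.
    Summing integrals over the basis requires the integrands to be integrable;
    on the edges this rests on the traces of beta being bounded almost
    everywhere, as limits of values of beta ([flux_bound]), and the traces of
    the discrete functions from both sides are identified through the fact that
    two triangles sharing a side lie on opposite sides of it
    ([outnormal_opp]). *)

(** * Integrals of finite sums *)

Section RintegralSum.
Context d (X : measurableType d) (R : realType).
Variables (mu : {measure set X -> \bar R}) (D : set X) (mD : measurable D).

Lemma integrable_rsum (I : Type) (r : seq I) (P : pred I) (F : I -> X -> R) :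
  (forall i, P i -> mu.-integrable D (EFin \o F i)) ->
  mu.-integrable D (EFin \o (fun x => \sum_(i <- r | P i) F i x)).
Proof.
move=> iF; have -> : EFin \o (fun x => \sum_(i <- r | P i) F i x) =
    (fun x => \sum_(i <- r | P i) (F i x)%:E)%E.
  by apply/funext => x /=; rewrite sumEFin.
exact: integrable_sum.
Qed.

Lemma Rintegral_sum (I : Type) (r : seq I) (P : pred I) (F : I -> X -> R) :
  (forall i, P i -> mu.-integrable D (EFin \o F i)) ->
  (\int[mu]_(x in D) (\sum_(i <- r | P i) F i x))%R =
  \sum_(i <- r | P i) (\int[mu]_(x in D) F i x)%R.
Proof.
move=> iF; elim: r => [|i r IH].
  rewrite big_nil -[RHS](mul0r (fine (mu D))) -Rintegral_cst //.
  by apply: eq_Rintegral => x _; rewrite big_nil.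
rewrite big_cons -IH; case: ifPn => Pi.
  rewrite -RintegralD //; [|exact: iF|exact: integrable_rsum].
  by apply: eq_Rintegral => x _; rewrite big_cons Pi.
by apply: eq_Rintegral => x _; rewrite big_cons (negPf Pi).
Qed.

End RintegralSum.

(** * The plane measure *)

Section Measure.
Variable R : realType.
Notation lam := (@lebesgue_measure R).

(** The sigma-algebra on the plane is the product one, so an open set has to be
    written as a countable union of squares: those with rational centre and
    radius that it contains. *)
Lemma open_measurable_plane (A : set (R * R)) : open A -> measurable A.
Proof.
move=> oA.
pose F (a b r : rat) : set (R * R) :=
  let B := ball (ratr a : R) (ratr r) `*` ball (ratr b : R) (ratr r) in
  if `[< B `<=` A >] then B else set0.
suff -> : A = \bigcup_a \bigcup_b \bigcup_r F a b r.
  do 3 apply: bigcupT_measurable_rat => ?.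
  rewrite /F; case: ifP => // _.
  by apply: measurableX; exact: measurable_ball.
apply/seteqP; split => [[x y] Axy|z [a _ [b _ [r _]]]]; last first.
  by rewrite /F; case: ifPn => // /asboolP; apply.
have /nbhs_ballP [e /= e0 eA] := open_nbhs_nbhs (conj oA Axy).
(* A radius below e / 2 and a centre at distance less than the radius keep the
   square inside the ball of radius e. *)
have [r] := @rat_in_itvoo R (e / 4) (e / 2) ltac:(lra).
rewrite in_itv/= => /andP[r1 r2].
have [a] := @rat_in_itvoo R (x - ratr r) (x + ratr r) ltac:(lra).
have [b] := @rat_in_itvoo R (y - ratr r) (y + ratr r) ltac:(lra).
rewrite !in_itv/= => /andP[b1 b2] /andP[a1 a2].
exists a => //; exists b => //; exists r => //; rewrite /F; case: ifPn.
  by move=> _; split; rewrite /= /ball/= ltr_norml; lra.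
move=> /asboolP; case=> -[u v] [] /=.
rewrite /ball/= !ltr_norml => /andP[u1 u2] /andP[v1 v2].
by apply: eA; split; rewrite /ball/= ltr_norml; apply/andP; split; lra.
Qed.

Lemma closed_measurable_plane (A : set (R * R)) : closed A -> measurable A.
Proof.
by move=> /closed_openC/open_measurable_plane/measurableC; rewrite setCK.
Qed.

Lemma lebesgue_measureD (c : R) (A : set R) : measurable A ->
  lam ((fun y => y + c) @^-1` A) = lam A.
Proof.
move=> mA.
have mf : measurable_fun [set: measurableTypeR R]
    ((fun y => y + c) : _ -> measurableTypeR R) by exact: measurable_funD.
pose f : {mfun measurableTypeR R >-> measurableTypeR R} :=
  HB.pack (fun y => y + c : measurableTypeR R) (isMeasurableFun.Build _ _ _ _ _ mf).
apply/esym/(@lebesgue_measure_unique R (pushforward lam f)) => //= _ [[a b]] _ <-.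
rewrite /pushforward.
have -> : f @^-1` [set` `]a, b]] = [set` `](a - c), (b - c)]] :> set R.
  by apply/seteqP; split => x /=; rewrite !in_itv/=; lra.
by rewrite !lebesgue_measure_itv/= !lte_fin ltrD2r -!EFinD; case: ifP => // _;
   congr (_%:E); lra.
Qed.

(** The measure of the plane is defined by vertical sections; horizontal shears
    and vertical lines are seen by the horizontal ones. *)
Lemma mu2_ysection (A : set (R * R)) : measurable A ->
  mu2 A = (\int[lam]_y lam (ysection A y))%E.
Proof.
move=> mA; rewrite /mu2.
apply: (@product_measure_unique _ _ _ _ _ lam lam (lam \x^ lam)%E) => //.
by move=> B C mB mC; exact: product_measure2E.
Qed.

Definition vshear (a b : R) (z : R * R) : R * R := (z.1, z.2 + (a * z.1 + b)).
Definition hshear (a b : R) (z : R * R) : R * R := (z.1 + (a * z.2 + b), z.2).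

Lemma measurable_vshear a b : measurable_fun setT (vshear a b).
Proof.
apply: measurable_fun_pair => //=.
apply: measurable_funD => //=; apply: measurable_funD => //=.
by apply: measurable_funM.
Qed.

Lemma measurable_hshear a b : measurable_fun setT (hshear a b).
Proof.
apply: measurable_fun_pair => //=.
apply: measurable_funD => //=; apply: measurable_funD => //=.
by apply: measurable_funM.
Qed.

(** A vertical shear translates each vertical section. *)
Lemma mu2_vshear a b (A : set (R * R)) : measurable A ->
  mu2 (vshear a b @^-1` A) = mu2 A.
Proof.
move=> mA; rewrite /mu2 /product_measure1; apply: eq_integral => x _ /=.
rewrite -(@lebesgue_measureD (a * x + b) (xsection A x)); last first.
  exact: measurable_xsection.
congr (lam _); apply/seteqP; split => y /=; rewrite /xsection/= !inE//=.
Qed.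

Lemma mu2_hshear a b (A : set (R * R)) : measurable A ->
  mu2 (hshear a b @^-1` A) = mu2 A.
Proof.
move=> mA; rewrite !mu2_ysection //; last first.
  by rewrite -[X in measurable X]setTI; exact: measurable_hshear.
apply: eq_integral => y _ /=.
rewrite -(@lebesgue_measureD (a * y + b) (ysection A y)); last first.
  exact: measurable_ysection.
congr (lam _); apply/seteqP; split => x /=; rewrite /ysection/= !inE//=.
Qed.

(** Every section of a line in one of the two axis directions has at most one
    point. *)
Lemma mu2_line (c : R) (g : R * R) : g != 0 ->
  mu2 [set x | c + dot g x = 0] = 0%E.
Proof.
move=> g0; pose Z := [set x : R * R | c + dot g x = 0].
have mZ : measurable Z.
  rewrite (_ : Z = (fun x => c + dot g x) @^-1` [set 0])//.
  rewrite -[X in measurable X]setTI.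
  have : measurable_fun setT (fun x : R * R => c + dot g x).
    by apply: measurable_funD => //; apply: measurable_funD => //;
       apply: measurable_funM.
  by apply => //; exact: measurable_set1.
have [g2|g2] := eqVneq g.2 0.
- rewrite mu2_ysection // integral0_eq // => y _.
  have [g1 _] : g.1 != 0 /\ g.2 = 0.
    by split => //; apply: contraNneq g0 => g1; rewrite [g]surjective_pairing g1 g2.
  rewrite (_ : ysection _ y = [set - c / g.1]) ?lebesgue_measure_set1//.
  apply/seteqP; split => x /=; rewrite /ysection/= inE /Z /dot /= g2 mul0r addr0.
    by move=> h; apply: (mulfI g1); rewrite mulrCA divff// mulr1; lra.
  by move=> ->; rewrite mulrCA divff//; lra.
- rewrite /mu2 /product_measure1 integral0_eq // => x _ /=.
  rewrite (_ : xsection _ x = [set (- c - g.1 * x) / g.2]) ?lebesgue_measure_set1//.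
  apply/seteqP; split => y /=; rewrite /xsection/= inE /Z /dot /=.
    by move=> h; apply: (mulfI g2); rewrite mulrCA divff// mulr1; lra.
  by move=> ->; rewrite mulrCA divff//; lra.
Qed.

Lemma mu2_open_gt0 (A : set (R * R)) : open A -> A !=set0 -> (0 < mu2 A)%E.
Proof.
move=> oA [[x y] Axy].
have /nbhs_ballP [e /= e0 eA] := open_nbhs_nbhs (conj oA Axy).
have mB (z : R) : measurable (ball z e) by exact: measurable_ball.
apply: (@lt_le_trans _ _ (mu2 (ball x e `*` ball y e))); last first.
  apply: le_measure; rewrite ?inE.
  - by apply: measurableX; exact: mB.
  - exact: open_measurable_plane.
  - by move=> z [z1 z2]; apply: eA.
have -> : mu2 (ball x e `*` ball y e) = (lam (ball x e) * lam (ball y e))%E.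
  by apply: product_measure1E; exact: mB.
rewrite !lebesgue_measure_ball ?ltW //.
by rewrite -EFinM lte_fin mulr_gt0 // mulrn_wgt0.
Qed.

Lemma mu2_bounded_lty (A : set (R * R)) : measurable A -> bounded_set A ->
  (mu2 A < +oo)%E.
Proof.
move=> mA [M [_ /(_ (`|M| + 1))]] bA.
have {}bA z : A z -> `|z| <= `|M| + 1 by apply: bA; rewrite ltr_pwDr// ler_norm.
pose I : set R := `[- (`|M| + 1), `|M| + 1]%classic.
have mI : measurable I by exact: measurable_itv.
apply: (@le_lt_trans _ _ (mu2 (I `*` I))); last first.
  have -> : mu2 (I `*` I) = (lam I * lam I)%E by apply: product_measure1E; exact: mI.
  rewrite !lebesgue_measure_itv /=.
  by case: ifP => _; rewrite ?mule0 ?ltry // -!EFinD -EFinM ltry.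
apply: le_measure; rewrite ?inE //; first exact: measurableX.
move=> z /bA; rewrite /Num.Def.normr/= ge_max => /andP[] /=.
by rewrite !ler_norml /I => z1 z2; split; rewrite /= in_itv.
Qed.

End Measure.

(** * Barycentric coordinates *)

Section Bary.
Variable R : realType.

Lemma ord3_ind (P : 'I_3 -> Prop) : P 0 -> P 1 -> P 2 -> forall k, P k.
Proof.
move=> P0 P1 P2 [[|[|[|//]]] Hk].
- by rewrite (_ : Ordinal _ = 0) //; apply: val_inj.
- by rewrite (_ : Ordinal _ = 1) //; apply: val_inj.
- by rewrite (_ : Ordinal _ = 2) //; apply: val_inj.
Qed.

(** Sides and vertices are indexed modulo 3, so identities about a generic index
    are checked on the three indices after evaluating these sums. *)
Lemma ord3_addE : (((0 + 1)%R = 1%R :> 'I_3) *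
  ((0 + 2)%R = 2%R :> 'I_3) *
  ((1 + 1)%R = 2%R :> 'I_3) *
  ((1 + 2)%R = 0%R :> 'I_3) *
  ((2 + 1)%R = 0%R :> 'I_3) *
  ((2 + 2)%R = 1%R :> 'I_3))%type.
Proof. by do !split; apply: val_inj. Qed.

Lemma sum_ord3 (V : nmodType) (F : 'I_3 -> V) : \sum_k F k = F 0 + F 1 + F 2.
Proof.
rewrite !big_ord_recl big_ord0 addr0 addrA.
by congr (F _ + F _ + F _); apply: val_inj.
Qed.

Lemma pair_ext (A B : Type) (x y : A * B) : x.1 = y.1 -> x.2 = y.2 -> x = y.
Proof. by case: x y => [? ?] [? ?] /= -> ->. Qed.

Lemma sum_ord3_cyc (V : nmodType) (F : 'I_3 -> V) k :
  \sum_j F j = F k + F (k + 1) + F (k + 2).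
Proof.
move: k; apply: ord3_ind; rewrite !ord3_addE sum_ord3 //.
- by rewrite -addrA addrC.
- by rewrite addrC addrA.
Qed.

Lemma ord3_cyc_ind (k : 'I_3) (P : 'I_3 -> Prop) :
  P k -> P (k + 1) -> P (k + 2) -> forall j, P j.
Proof. by move: k; apply: ord3_ind; rewrite !ord3_addE => *; apply: ord3_ind. Qed.

Variable p : 'I_3 -> R * R.
Implicit Types (q : R * (R * R)) (x n : R * R).

(** The k-th barycentric coordinate, in the encoding of affine functions by value
    at the origin and gradient: the gradient is the side opposite to the k-th
    vertex, turned by a right angle and divided by twice the signed area. *)
Definition bary (k : 'I_3) : R * (R * R) :=
  let d := (side p k).2 - (side p k).1 in
  let g := ((- d.2 / orient p, d.1 / orient p) : R * R) in
  (- dot g (p (k + 1)), g).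

Hypothesis p0 : orient p != 0.

Lemma bary_vtx k j : aff (bary k) (p j) = (k == j)%:R.
Proof.
move: p0; rewrite /aff /bary /dot /side /orient /=.
move: k j; apply: ord3_ind; apply: ord3_ind; rewrite !ord3_addE /= => D0; field; exact: D0.
Qed.

Lemma sum_bary x : \sum_k aff (bary k) x = 1.
Proof.
move: p0; rewrite sum_ord3 /aff /bary /dot /side /orient /= !ord3_addE => D0; field; exact: D0.
Qed.

Lemma aff_comb q (l : 'I_3 -> R) (P : 'I_3 -> R * R) : \sum_k l k = 1 ->
  aff q (\sum_k l k *: P k) = \sum_k l k * aff q (P k).
Proof.
rewrite !sum_ord3 /aff /dot /= => h.
by rewrite -[X in X + _ = _]mul1r -h /GRing.scale /=; ring.
Qed.

Lemma bary_decomp x : x = \sum_k aff (bary k) x *: p k.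
Proof.
move: p0; rewrite sum_ord3 /aff /bary /dot /side /orient /= !ord3_addE => D0.
apply: pair_ext; rewrite /= /GRing.scale /=; field; exact: D0.
Qed.

Lemma aff_bary q x : aff q x = \sum_k aff (bary k) x * aff q (p k).
Proof. by rewrite {1}(bary_decomp x) aff_comb // sum_bary. Qed.

Lemma bary_of_comb l k : \sum_j l j = 1 -> aff (bary k) (\sum_j l j *: p j) = l k.
Proof.
move=> h; rewrite aff_comb // (bigD1 k) //= bary_vtx eqxx mulr1 big1 ?addr0 //.
by move=> j jk; rewrite bary_vtx eq_sym (negPf jk) mulr0.
Qed.

Lemma triangle_bary : triangle p = [set x | forall k, 0 <= aff (bary k) x].
Proof.
apply/seteqP; split => [x [l [l0 l1 ->]] k|x /= h].
  by rewrite bary_of_comb.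
exists (fun k => aff (bary k) x); split => //; first exact: sum_bary.
exact: bary_decomp.
Qed.

Lemma bary_neq0 k : (bary k).2 != 0.
Proof.
apply/eqP => h; have := bary_vtx k k; have := bary_vtx k (k + 1).
rewrite eqxx /aff h /dot /= !mul0r !addr0 => -> /eqP.
by move: k {h}; apply: ord3_ind; rewrite !ord3_addE /= eq_sym oner_eq0.
Qed.

End Bary.

(** * Affine functions *)

Section Aff.
Variable R : realType.
Implicit Type q : R * (R * R).
Implicit Type x n : R * R.

Lemma aff_move q x n (e : R) : aff q (x - e *: n) = aff q x - e * dot q.2 n.
Proof. by rewrite /aff /dot /= /GRing.scale /=; ring. Qed.

Lemma continuous_aff q : continuous (aff q).
Proof.
move=> x; rewrite /aff /dot; apply: cvgD; first exact: cvg_cst.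
by apply: cvgD; apply: cvgM; [exact: cvg_cst | exact: cvg_fst |
   exact: cvg_cst | exact: cvg_snd].
Qed.

Lemma measurable_aff q : measurable_fun setT (aff q).
Proof.
by apply: measurable_funD => //; apply: measurable_funD => //;
   apply: measurable_funM.
Qed.

Lemma dot_gt0 (g : R * R) : g != 0 -> 0 < dot g g.
Proof.
move=> g0; rewrite /dot -!expr2 lt0r paddr_eq0 ?sqr_ge0// !sqrf_eq0.
rewrite addr_ge0 ?sqr_ge0 // andbT.
by apply: contra g0 => /andP[/eqP h1 /eqP h2]; rewrite [g]surjective_pairing h1 h2.
Qed.

Lemma cvg_line x n : x - e *: n @[e --> (0:R)^'+] --> x.
Proof.
rewrite -[X in _ --> X]subr0 -[X in _ - X](scale0r n).
apply: cvgB; first exact: cvg_cst.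
apply: cvgZr_tmp; apply: cvg_at_right_filter; exact: cvg_id.
Qed.

(** A nonconstant affine function that vanished at an interior point would be
    negative a little further against its gradient. *)
Lemma interior_aff_gt0 (A : set (R * R)) q x : q.2 != 0 ->
  (forall y, A y -> 0 <= aff q y) -> A° x -> 0 < aff q x.
Proof.
move=> q0 Aq Ax.
have : \forall e \near (0:R)^'+, A (x - e *: q.2) by exact: cvg_line Ax.
move=> near_A; have : \forall e \near (0:R)^'+, 0 < e /\ A (x - e *: q.2).
  by apply: filterI => //; exact: nbhs_right_gt.
move=> /filter_ex [e [e0 /Aq]]; rewrite aff_move => h.
by have := mulr_gt0 e0 (dot_gt0 q0); lra.
Qed.

Lemma aff_gt0_open q : open [set x | 0 < aff q x].
Proof.
apply: (@open_comp _ _ (aff q) [set y | 0 < y]); last exact: open_gt.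
by move=> x _; exact: continuous_aff.
Qed.

Lemma aff_ge0_closed q : closed [set x | 0 <= aff q x].
Proof.
apply: (@closed_comp _ _ (aff q) [set y | 0 <= y]); last exact: closed_ge.
by move=> x _; exact: continuous_aff.
Qed.

End Aff.

(** * Integrals over a triangle *)

Section Tri.
Variable R : realType.
Variable p : 'I_3 -> R * R.
Hypothesis p0 : orient p != 0.
Implicit Types (q : R * (R * R)) (x n : R * R).

Lemma bary_gt0_interior x : (forall k, 0 < aff (bary p k) x) ->
  (triangle p)° x.
Proof.
move=> h; rewrite /interior (triangle_bary p0) /=.
have nk k : \forall y \near x, 0 < aff (bary p k) y.
  apply: (@open_nbhs_nbhs _ x [set y | 0 < aff (bary p k) y]).
  by split; [exact: aff_gt0_open | exact: h].
near=> y; apply: ord3_ind; apply: ltW; near: y; exact: nk.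
Unshelve. all: by end_near. Qed.

Lemma interior_triangle :
  (triangle p)° = [set x | forall k, 0 < aff (bary p k) x].
Proof.
apply/seteqP; split => [x h k|x h]; last exact: bary_gt0_interior.
apply: interior_aff_gt0 h; first exact: bary_neq0.
by rewrite (triangle_bary p0) => y /(_ k).
Qed.

Lemma interior_triangle_nonempty : (triangle p)° !=set0.
Proof.
exists (\sum_k 3^-1 *: p k); apply: bary_gt0_interior => k.
rewrite (bary_of_comb p0 (l := fun=> 3^-1)) ?invr_gt0 //.
by rewrite sum_ord3; lra.
Qed.

Lemma triangle_bounded : bounded_set (triangle p).
Proof.
exists (\sum_k `|p k|); split; first exact: num_real.
move=> M hM x [l [l0 l1 ->]]; apply: le_trans (ltW hM).
apply: le_trans (ler_norm_sum _ _ _) _; apply: ler_sum => k _.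
rewrite normrZ ger0_norm // ler_piMl //.
by rewrite -l1 (bigD1 k) //= lerDl sumr_ge0.
Qed.

Lemma triangle_closed : closed (triangle p).
Proof.
rewrite (triangle_bary p0).
have -> : [set x | forall k, 0 <= aff (bary p k) x] =
    \bigcap_(k in [set: 'I_3]) [set x | 0 <= aff (bary p k) x].
  by apply/seteqP; split => y hy k; [move=> _; exact: hy | exact: hy k I].
by apply: closed_bigI => k _; exact: aff_ge0_closed.
Qed.

Lemma measurable_triangle : measurable (triangle p).
Proof. by apply: closed_measurable_plane; exact: triangle_closed. Qed.

Lemma measurable_itriangle : measurable (triangle p)°.
Proof. by apply: open_measurable_plane; exact: open_interior. Qed.

Lemma itriangle_lty : (mu2 (triangle p)° < +oo)%E.
Proof.
apply: mu2_bounded_lty; first exact: measurable_itriangle.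
have [M [Mr h]] := triangle_bounded.
by exists M; split => // N MN x /interior_subset; exact: h.
Qed.

(** The boundary of a triangle lies on the three lines carrying its sides. *)
Lemma mu2_triangle : mu2 (triangle p) = mu2 (triangle p)°.
Proof.
pose Z k := [set x | aff (bary p k) x = 0].
have Z0 k : mu2 (Z k) = 0%E by apply: mu2_line; exact: bary_neq0.
have mZ k : measurable (Z k).
  rewrite -[X in measurable X]setTI.
  have := measurable_aff (bary p k) measurableT.
  by move=> /(_ [set 0]); apply; exact: measurable_set1.
apply/eqP; rewrite eq_le; apply/andP; split; last first.
  apply: le_measure; rewrite ?inE; [exact: measurable_itriangle|
    exact: measurable_triangle| exact: interior_subset].
have sub : triangle p `<=` (triangle p)° `|` (Z 0 `|` (Z 1 `|` Z 2)).
  rewrite interior_triangle (triangle_bary p0) => x /= h.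
  have [|h0] := eqVneq (aff (bary p 0) x) 0; first by right; left.
  have [|h1] := eqVneq (aff (bary p 1) x) 0; first by right; right; left.
  have [|h2] := eqVneq (aff (bary p 2) x) 0; first by right; right; right.
  by left; apply: ord3_ind; rewrite lt0r ?h0 ?h1 ?h2 h.
have null_union (A B : set (R * R)) : measurable A -> measurable B ->
    mu2 B = 0%E -> (mu2 (A `|` B) <= mu2 A)%E.
  move=> mA mB B0; rewrite -[leRHS]adde0 -[X in (_ <= _ + X)%E]B0.
  exact: measureU2.
have nullU k (B : set (R * R)) : measurable B -> mu2 B = 0%E ->
    mu2 (Z k `|` B) = 0%E.
  move=> mB B0; apply/eqP; rewrite eq_le measure_ge0 andbT -(Z0 k).
  exact: null_union.
have mZZ : measurable (Z 1 `|` Z 2) by exact: measurableU.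
have mZZZ : measurable (Z 0 `|` (Z 1 `|` Z 2)) by exact: measurableU.
have mI := measurable_itriangle.
apply: (@le_trans _ _ (mu2 ((triangle p)° `|` (Z 0 `|` (Z 1 `|` Z 2))))).
  apply: le_measure; rewrite ?inE //; first exact: measurable_triangle.
  exact: measurableU.
have ZZ0 := nullU 1 _ (mZ 2) (Z0 2).
exact: (null_union _ _ mI mZZZ (nullU 0 _ mZZ ZZ0)).
Qed.

Lemma aff_bounded q : exists M, forall x, triangle p x -> `|aff q x| <= M.
Proof.
exists (\sum_k `|aff q (p k)|) => x [l [l0 l1 ->]]; rewrite aff_comb //.
apply: le_trans (ler_norm_sum _ _ _) _; apply: ler_sum => k _.
rewrite normrM ger0_norm // ler_piMl //.
by rewrite -l1 (bigD1 k) //= lerDl sumr_ge0.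
Qed.

(** The affine map sending each vertex to the next one. *)
Definition vtx_rot x : R * R := \sum_k aff (bary p k) x *: p (k + 1).

Lemma bary_vtx_rot k x : aff (bary p (k + 1)) (vtx_rot x) = aff (bary p k) x.
Proof.
have -> : vtx_rot x = \sum_j aff (bary p (j - 1)) x *: p j.
  rewrite /vtx_rot [RHS](reindex_inj (addIr 1)) /=.
  by apply: eq_bigr => j _; rewrite addrK.
rewrite (bary_of_comb p0 (l := fun j => aff (bary p (j - 1)) x)); first by rewrite addrK.
rewrite -[RHS](sum_bary p0 x) [LHS](reindex_inj (addIr 1)) /=.
by apply: eq_bigr => j _; rewrite addrK.
Qed.

Lemma vtx_rot_itriangle : vtx_rot @^-1` (triangle p)° = (triangle p)°.
Proof.
rewrite interior_triangle; apply/seteqP; split => x /= h k.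
  by rewrite -bary_vtx_rot.
by rewrite -(subrK 1 k) bary_vtx_rot.
Qed.

(** A matrix of determinant 1 with upper right entry t <> 0 is a product of three
    shears, with parameters (d - 1) / t, t and (a - 1) / t where a and d are its
    diagonal entries.  The linear part of the cyclic map has order 3, hence no
    real eigenvector, and t cannot vanish; concretely t is, up to the sign and
    the determinant D, a definite quadratic form in the first coordinates of two
    sides. *)
Lemma vtx_rot_shear : exists a b c d e f,
  vtx_rot = vshear a b \o hshear c d \o vshear e f.
Proof.
pose a1 := (p 1).1 - (p 0).1; pose a2 := (p 1).2 - (p 0).2.
pose b1 := (p 2).1 - (p 0).1; pose b2 := (p 2).2 - (p 0).2.
pose D := a1 * b2 - a2 * b1.
have D0 : D != 0 by [].
pose t := - (a1 ^+ 2 - a1 * b1 + b1 ^+ 2) / D.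
have t0 : a1 ^+ 2 - a1 * b1 + b1 ^+ 2 != 0.
  apply: contraNneq D0 => h; have a10 : a1 = 0.
    apply/eqP; rewrite -sqrf_eq0 eq_le sqr_ge0 andbT.
    by have := sqr_ge0 (b1 - a1 / 2); nra.
  have b10 : b1 = 0.
    apply/eqP; rewrite -sqrf_eq0 eq_le sqr_ge0 andbT.
    by have := sqr_ge0 (a1 - b1 / 2); nra.
  by rewrite /D a10 b10; apply/eqP; ring.
pose A11 := ((b1 - a1) * b2 + a1 * a2) / D.
pose A22 := ((b2 - a2) * - b1 - a2 * a1) / D.
pose A21 := ((b2 - a2) * b2 + a2 * a2) / D.
pose c1 := (p 1).1 - (A11 * (p 0).1 + t * (p 0).2).
pose c2 := (p 1).2 - (A21 * (p 0).1 + A22 * (p 0).2).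
exists ((A22 - 1) / t), (c2 - (A22 - 1) / t * c1), t, c1, ((A11 - 1) / t), 0.
apply/funext => x; rewrite /vtx_rot sum_ord3 !ord3_addE.
apply: pair_ext; rewrite /= /GRing.scale /=;
  rewrite /bary /aff /side /dot /= !ord3_addE -[orient p]/D
    /c2 /c1 /A11 /A22 /A21 /t /D /a1 /a2 /b1 /b2;
  by field; apply/andP; split; [exact: D0 | exact: t0].
Qed.

Lemma measurable_vtx_rot : measurable_fun setT vtx_rot.
Proof.
have [a [b [c [d [e [f ->]]]]]] := vtx_rot_shear.
apply: measurableT_comp; last exact: measurable_vshear.
by apply: measurableT_comp; [exact: measurable_vshear|exact: measurable_hshear].
Qed.

Lemma measurable_preimage (f : R * R -> R * R) (A : set (R * R)) :
  measurable_fun setT f -> measurable A -> measurable (f @^-1` A).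
Proof.
by move=> mf mA; rewrite -[X in measurable X]setTI; exact: mf.
Qed.

Lemma mu2_vtx_rot (A : set (R * R)) : measurable A -> mu2 (vtx_rot @^-1` A) = mu2 A.
Proof.
move=> mA; have [a [b [c [d [e [f ->]]]]]] := vtx_rot_shear.
rewrite !comp_preimage mu2_vshear ?mu2_hshear ?mu2_vshear //.
  exact: measurable_preimage (measurable_vshear _ _) mA.
apply: measurable_preimage (measurable_hshear _ _) _.
exact: measurable_preimage (measurable_vshear _ _) mA.
Qed.

Lemma integrable_bounded (D : set (R * R)) (f : R * R -> R) (C : R) :
  measurable D -> D `<=` (triangle p)° -> measurable_fun D f ->
  (forall x, D x -> `|f x| <= C) -> (@mu2 R).-integrable D (EFin \o f).
Proof.
move=> mD DT mf fC; apply: measurable_bounded_integrable => //.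
- apply: le_lt_trans itriangle_lty; apply: le_measure; rewrite ?inE //.
  exact: measurable_itriangle.
- exists C; split; first exact: num_real.
  by move=> M CM x Dx; apply: le_trans (fC x Dx) (ltW CM).
Qed.

Lemma integrable_aff q : (@mu2 R).-integrable (triangle p)° (EFin \o aff q).
Proof.
have [M hM] := aff_bounded q.
apply: (integrable_bounded (C := M)) => //.
- exact: measurable_itriangle.
- by apply: measurable_funTS; exact: measurable_aff.
- by move=> x /interior_subset; exact: hM.
Qed.

(** Change of variables along the cyclic map of the vertices. *)
Lemma int_bary_next k :
  (\int[@mu2 R]_(x in (triangle p)°) aff (bary p k) x =
   \int[@mu2 R]_(x in (triangle p)°) aff (bary p (k + 1)) x)%R.
Proof.
pose f := aff (bary p (k + 1)).
have fE : aff (bary p k) = f \o vtx_rot.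
  by apply/funext => x; rewrite /f /= bary_vtx_rot.
rewrite fE /Rintegral; congr fine.
pose X : measurableType _ := (measurableTypeR R * measurableTypeR R)%type.
have mf : measurable_fun [set: X] (EFin \o f : X -> \bar R).
  by apply/measurable_EFinP; exact: (measurable_aff (bary p (k + 1))).
have mr : measurable_fun [set: X] (vtx_rot : X -> X) by exact: measurable_vtx_rot.
have intf : (@mu2 R).-integrable ((vtx_rot : X -> X) @^-1` (triangle p)°) ((EFin \o f) \o vtx_rot).
  rewrite vtx_rot_itriangle.
  have -> : (EFin \o f) \o vtx_rot = EFin \o aff (bary p k) by rewrite fE.
  exact: integrable_aff.
have := integral_pushforward mr mf intf measurable_itriangle.
rewrite vtx_rot_itriangle => <-.
by apply: eq_measure_integral => A mA _; exact: mu2_vtx_rot.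
Qed.

(** The three coordinates have the same integral and sum to 1. *)
Lemma int_bary k :
  (\int[@mu2 R]_(x in (triangle p)°) aff (bary p k) x)%R =
  3^-1 * fine (mu2 (triangle p)°).
Proof.
pose I j := (\int[@mu2 R]_(x in (triangle p)°) aff (bary p j) x)%R.
have mI := measurable_itriangle.
have sumI : I k + I (k + 1) + I (k + 2) = fine (mu2 (triangle p)°).
  rewrite -(sum_ord3_cyc I) -Rintegral_sum //; last by move=> j _; exact: integrable_aff.
  rewrite -[RHS]mul1r -Rintegral_cst //; apply: eq_Rintegral => x _.
  by rewrite sum_bary.
have I1 : I k = I (k + 1) := int_bary_next k.
have I2 : I (k + 1) = I (k + 2).
  by rewrite [LHS]int_bary_next -addrA; congr (I (k + _)); apply: val_inj.
by rewrite -[LHS]/(I k) -sumI -I2 -I1; field.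
Qed.

Lemma int_aff q :
  (\int[@mu2 R]_(x in (triangle p)°) aff q x)%R =
  3^-1 * fine (mu2 (triangle p)°) * \sum_k aff q (p k).
Proof.
have mI := measurable_itriangle.
have ib k r : (@mu2 R).-integrable (triangle p)° (EFin \o (fun x => aff (bary p k) x * r)).
  have [M hM] := aff_bounded (bary p k).
  apply: (integrable_bounded (C := M * `|r|)) => //.
    by apply: measurable_funM => //; apply: measurable_funTS; exact: measurable_aff.
  by move=> x /interior_subset/hM ?; rewrite normrM ler_wpM2r.
under eq_Rintegral do rewrite (aff_bary p0).
rewrite Rintegral_sum // mulr_sumr; apply: eq_bigr => k _.
by rewrite RintegralZr ?int_bary //; exact: integrable_aff.
Qed.

End Tri.

(** * Edges and midpoints *)

Section Edges.
Variable R : realType.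
Implicit Types (q : R * (R * R)) (x n : R * R) (e : (R * R) * (R * R)) (s : R).

Lemma edge_pt_rev e s : edge_pt (e.2, e.1) s = edge_pt e (1 - s).
Proof. by rewrite /edge_pt /= subKr addrC. Qed.

Lemma same_edge_pt e e' s : same_edge e e' ->
  edge_pt e s = edge_pt e' s \/ edge_pt e s = edge_pt e' (1 - s).
Proof. by move=> [->|->]; [left|right; rewrite edge_pt_rev]. Qed.

Lemma same_edge_midpoint e e' : same_edge e e' -> midpoint e = midpoint e'.
Proof.
move=> /(same_edge_pt 2^-1); rewrite /midpoint.
by rewrite (_ : 1 - 2^-1 = 2^-1 :> R); [case|field].
Qed.

Lemma same_edge_sym e e' : same_edge e e' -> same_edge e' e.
Proof. by case: e e' => [a b] [c d] [[-> ->]|[-> ->]]; [left|right]. Qed.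

Lemma same_edge_trans e e' e'' :
  same_edge e e' -> same_edge e' e'' -> same_edge e e''.
Proof.
case: e e' e'' => [a b] [c d] [u v].
by move=> [[-> ->]|[-> ->]] [[-> ->]|[-> ->]]; by [left|right].
Qed.

Lemma aff_edge_pt q e s :
  aff q (edge_pt e s) = (1 - s) * aff q e.1 + s * aff q e.2.
Proof. by rewrite /aff /edge_pt /dot /= /GRing.scale /=; ring. Qed.

Lemma aff_midpoint q e : aff q (midpoint e) = 2^-1 * (aff q e.1 + aff q e.2).
Proof. by rewrite /midpoint aff_edge_pt; field. Qed.

Variable p : 'I_3 -> R * R.
Hypothesis p0 : orient p != 0.

Lemma bary_side k s : 
  [/\ aff (bary p k) (edge_pt (side p k) s) = 0,
      aff (bary p (k + 1)) (edge_pt (side p k) s) = 1 - s &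
      aff (bary p (k + 2)) (edge_pt (side p k) s) = s].
Proof.
rewrite !aff_edge_pt !(bary_vtx p0) /side /=.
by move: k; apply: ord3_ind; rewrite !ord3_addE /=; split; ring.
Qed.

Lemma bary_midpoint k j :
  aff (bary p j) (midpoint (side p k)) = 2^-1 * (j != k)%:R.
Proof.
rewrite aff_midpoint !(bary_vtx p0) /side /=.
by move: j k; apply: ord3_ind; apply: ord3_ind; rewrite !ord3_addE /=; field.
Qed.

(** The function 1 - 2 lambda_k is 1 at the midpoint of the k-th side and 0 at
    the other two. *)
Lemma aff_midpoints q x : aff q x =
  \sum_k aff q (midpoint (side p k)) * (1 - 2 * aff (bary p k) x).
Proof.
rewrite (aff_bary p0) !sum_ord3 !aff_midpoint /side /= !ord3_addE.
have := sum_bary p0 x; rewrite sum_ord3 => h.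
have -> : aff (bary p 2) x = 1 - aff (bary p 0) x - aff (bary p 1) x by rewrite -h; ring.
by field.
Qed.

Lemma sum_vtx_midpoint q :
  \sum_k aff q (p k) = \sum_k aff q (midpoint (side p k)).
Proof. by rewrite !sum_ord3 !aff_midpoint /side /= !ord3_addE; field. Qed.

(** The k-th coordinate vanishes at the midpoint of the k-th side only. *)
Lemma side_inj k j : same_edge (side p k) (side p j) -> k = j.
Proof.
move=> /same_edge_midpoint h; apply/eqP; apply: contraT => kj.
have := bary_midpoint k k; rewrite h bary_midpoint eqxx kj !mulr0 mulr1.
by move=> /eqP; rewrite invr_eq0 pnatr_eq0.
Qed.

End Edges.

(** * The Crouzeix-Raviart basis and the mass matrix *)

Section Mesh.
Variables (R : realType) (Omega : set (R * R)) (T : triangulation Omega).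
Variable phi : 'I_(nedge T) -> broken T.
Hypothesis pdO : polygonal_domain Omega.
Hypothesis phiB : CR_basis phi.
Implicit Types (q : R * (R * R)) (x n : R * R) (K L : 'I_(ntri T)) (v : broken T).

(** By conformity the intersection of two triangles lies on one of the lines
    carrying a side of the first, where a barycentric coordinate vanishes. *)
Lemma otri_disjoint K L : K != L -> otri K `&` otri L = set0.
Proof.
move=> KL; rewrite -subset0 => x [xK xL].
have xI : (triangle (vtx K) `&` triangle (vtx L)) x.
  by split; exact: interior_subset.
have K0 := tri_nondegenerate (t:=T) K.
move: xK; rewrite /otri (interior_triangle K0) /= => xK.
have [k xk] : exists k, aff (bary (vtx K) k) x = 0.
  case: (tri_conform KL) => [I0|[k [l [_ I1]]]|[k [l [_ I2]]]].
  - by move: xI; rewrite I0.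
  - move: xI; rewrite I1 => ->; exists (k + 1); rewrite (bary_vtx K0).
    by move: k {I1}; apply: ord3_ind.
  - move: xI; rewrite I2 => -[s _ <-]; exists k.
    by have [] := bary_side K0 k s.
by have := xK k; rewrite xk ltxx.
Qed.

(** This is where slits are excluded: the interior of a triangle lies in the
    interior of the closure of the domain. *)
Lemma otri_sub K : otri K `<=` Omega.
Proof.
move=> x xK; rewrite (pd_no_slit pdO).
have tc : triangle (vtx K) `<=` closure Omega.
  by move=> y yK; rewrite (tri_cover T); exists K.
exact: interiorS tc _ xK.
Qed.

Lemma broken_fun_otri v K x : otri K x -> broken_fun v x = aff (v K) x.
Proof.
move=> xK; rewrite /broken_fun (bigD1 K) //= big1 ?addr0.
  by rewrite indicE mem_set // mulr1.
move=> L LK; rewrite indicE memNset ?mulr0 // => xL.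
by have : (otri L `&` otri K) x by []; rewrite otri_disjoint.
Qed.

Lemma broken_fun_neq0 v x : broken_fun v x != 0 ->
  exists2 K, otri K x & aff (v K) x != 0.
Proof.
move=> h; apply/not_exists2P => H; move/eqP: h; apply.
rewrite /broken_fun big1 // => K _; rewrite indicE.
case: (H K) => [nK|/negP/negPn/eqP ->]; last by rewrite mul0r.
by rewrite memNset ?mulr0.
Qed.

(** At the midpoint of each side exactly one basis function is 1 and the others
    vanish, and affine functions are determined by these three values. *)
Lemma sum_phi K x : \sum_i aff (phi i K) x = 1.
Proof.
have K0 := tri_nondegenerate (t:=T) K.
transitivity (\sum_i \sum_k
    aff (phi i K) (midpoint (side (vtx K) k)) * (1 - 2 * aff (bary (vtx K) k) x)).
  by apply: eq_bigr => i _; exact: aff_midpoints.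
rewrite exchange_big /=.
transitivity (\sum_k (1 - 2 * aff (bary (vtx K) k) x)).
  apply: eq_bigr => k _; rewrite -mulr_suml -[RHS]mul1r; congr (_ * _).
  have [i ik] := side_edge (t:=T) K k.
  rewrite (bigD1 i) //= -(same_edge_midpoint ik) (phiB.2 i i K k ik) eqxx.
  rewrite big1 ?addr0 // => j ji.
  by rewrite (phiB.2 j i K k ik) (negPf ji).
rewrite big_split /= sumrN -mulr_sumr (sum_bary K0) sum_ord3; ring.
Qed.

Definition has_edge K (i : 'I_(nedge T)) :=
  [exists k, `[< same_edge (edge i) (side (vtx K) k) >]].

Lemma phi_midpoint i K k : aff (phi i K) (midpoint (side (vtx K) k)) =
  `[< same_edge (edge i) (side (vtx K) k) >]%:R.
Proof.
have [j jk] := side_edge (t:=T) K k.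
rewrite -(same_edge_midpoint jk) (phiB.2 i j K k jk).
suff -> : (i == j) = `[< same_edge (edge i) (side (vtx K) k) >] by [].
apply/eqP/asboolP => [-> //|ik]; apply: (edge_inj (t:=T)).
exact: same_edge_trans ik (same_edge_sym jk).
Qed.

Lemma sum_phi_midpoint i K :
  \sum_k aff (phi i K) (midpoint (side (vtx K) k)) = (has_edge K i)%:R.
Proof.
have K0 := tri_nondegenerate (t:=T) K.
under eq_bigr do rewrite phi_midpoint.
rewrite /has_edge; case: existsP => [[k /asboolP ik]|h].
  rewrite (bigD1 k) //= asboolT // big1 ?addr0 // => j jk.
  rewrite asboolF // => ij; move/eqP: jk; apply.
  by apply: (side_inj K0); apply: same_edge_trans (same_edge_sym ij) ik.
rewrite big1 // => k _; rewrite asboolF // => ik; apply: h; exists k.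
exact/asboolP.
Qed.

Definition area K : R := fine (mu2 (otri K)).

Lemma int_phi i K :
  (\int[@mu2 R]_(x in otri K) aff (phi i K) x)%R = 3^-1 * area K * (has_edge K i)%:R.
Proof.
have K0 := tri_nondegenerate (t:=T) K.
by rewrite /otri int_aff // sum_vtx_midpoint sum_phi_midpoint.
Qed.

Lemma measurable_otri K : measurable (otri K).
Proof. by apply: open_measurable_plane; exact: open_interior. Qed.

Lemma measurable_Omega : measurable Omega.
Proof. by apply: open_measurable_plane; exact: pd_open pdO. Qed.

Lemma aff_indic v K : (fun x => aff (v K) x * \1_(otri K) x) = aff (v K) \_ (otri K).
Proof.
apply/funext => x; rewrite patchE indicE; case: ifPn => _; by rewrite ?mulr1 ?mulr0.
Qed.

Lemma integrable_otri v K : (@mu2 R).-integrable Omega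
  (EFin \o (fun x => aff (v K) x * \1_(otri K) x)).
Proof.
have K0 := tri_nondegenerate (t:=T) K.
rewrite aff_indic -restrict_EFin; apply/integrable_restrict.
- exact: measurable_otri.
- exact: measurable_Omega.
- by rewrite setIidr; [exact: integrable_aff|exact: otri_sub].
Qed.

Lemma int_broken v : (\int[@mu2 R]_(x in Omega) broken_fun v x)%R =
  \sum_K (\int[@mu2 R]_(x in otri K) aff (v K) x)%R.
Proof.
rewrite Rintegral_sum; first 1 last.
- exact: measurable_Omega.
- by move=> K _; exact: integrable_otri.
apply: eq_bigr => K _; rewrite aff_indic -Rintegral_mkcondr setIidr //.
exact: otri_sub.
Qed.

Lemma area_lty K : (mu2 (otri K) < +oo)%E.
Proof. by apply: itriangle_lty; exact: tri_nondegenerate. Qed.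

Lemma area_gt0 K : 0 < area K.
Proof.
rewrite /area fine_gt0 // area_lty andbT.
apply: mu2_open_gt0; first exact: open_interior.
by apply: interior_triangle_nonempty; exact: tri_nondegenerate.
Qed.

Lemma phi_eq0 i K x : ~~ has_edge K i -> aff (phi i K) x = 0.
Proof.
move=> h; rewrite (aff_midpoints (tri_nondegenerate (t:=T) K)) big1 // => k _.
rewrite phi_midpoint asboolF ?mul0r // => ik.
by move: h => /existsPn/(_ k)/asboolP.
Qed.

(** The function takes the values 1 and 0 at two midpoints. *)
Lemma phi_grad_neq0 i K : has_edge K i -> (phi i K).2 != 0.
Proof.
have K0 := tri_nondegenerate (t:=T) K.
move=> /existsP[k /asboolP ik]; apply/eqP => g0.
have h1 := phi_midpoint i K k; have h2 := phi_midpoint i K (k + 1).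
move: h1 h2; rewrite asboolT // asboolF.
  by rewrite /aff g0 /dot /= !mul0r !addr0 => -> /eqP; rewrite oner_eq0.
move=> ik1; have : k = k + 1.
  by apply: (side_inj K0); apply: same_edge_trans (same_edge_sym ik) ik1.
by move: k {ik ik1}; apply: ord3_ind.
Qed.

Lemma mu2_phi_neq0 i K : has_edge K i ->
  mu2 (otri K `&` [set x | aff (phi i K) x != 0]) = mu2 (otri K).
Proof.
move=> Ki; pose Z := [set x | aff (phi i K) x = 0].
have mZ : measurable Z.
  have := measurable_aff (phi i K) measurableT.
  by move=> /(_ [set 0]) H; rewrite -[Z]setTI; apply: H; exact: measurable_set1.
have Z0 : mu2 Z = 0%E by apply: mu2_line; exact: phi_grad_neq0.
have mK := measurable_otri K.
have -> : otri K `&` [set x | aff (phi i K) x != 0] = otri K `\` Z.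
  by apply/seteqP; split => x [xK /= /eqP xZ]; split.
transitivity (mu2 (otri K) - mu2 (otri K `&` Z))%E.
  by apply: measureD => //; exact: area_lty.
have -> : mu2 (otri K `&` Z) = 0%E.
  apply/eqP; rewrite eq_le measure_ge0 andbT -Z0.
  apply: le_measure; rewrite ?inE //; exact: measurableI.
by rewrite sube0.
Qed.

(** The support lies in the union of the closed triangles having the edge i,
    and contains the open ones up to the zero lines of the basis function; both
    unions have the same measure. *)
Lemma mu2_support i :
  mu2 (CR_support (phi i)) = (\sum_(K | has_edge K i) mu2 (otri K))%E.
Proof.
pose r := [seq K <- index_enum 'I_(ntri T) | has_edge K i].
have rE K : (K \in r) = has_edge K i by rewrite mem_filter mem_index_enum andbT.
have ur : uniq r by rewrite filter_uniq // index_enum_uniq.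
have fr : finite_set [set` r] by exact: finite_finset.
have mS : measurable (CR_support (phi i)).
  by apply: closed_measurable_plane; exact: closed_closure.
rewrite -big_filter -/r (fsbig_seq _ _ ur).
apply/eqP; rewrite eq_le; apply/andP; split.
  have -> : (\sum_(K \in [set` r]) mu2 (otri K) = \sum_(K \in [set` r]) mu2 (triangle (vtx K)))%E.
    apply: eq_fsbigr => K _; rewrite mu2_triangle //; exact: tri_nondegenerate.
  apply: content_sub_fsum => //.
    by move=> K _; apply: measurable_triangle; exact: tri_nondegenerate.
  have cl : closed (\bigcup_(K in [set` r]) triangle (vtx K)).
    apply: closed_bigcup => // K _.
    by apply: triangle_closed; exact: tri_nondegenerate.
  rewrite /CR_support [X in _ `<=` X]((closure_id _).1 cl).
  apply: closure_subset => x /broken_fun_neq0[K xK h].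
  exists K; last exact: interior_subset.
  by rewrite /= rE; apply: contraNT h => /phi_eq0 ->.
pose F K := otri K `&` [set x | aff (phi i K) x != 0].
have mF K : measurable (F K).
  apply: measurableI; first exact: measurable_otri.
  have -> : [set x | aff (phi i K) x != 0] = aff (phi i K) @^-1` (~` [set 0]).
    by apply/seteqP; split => x /= /eqP.
  have := measurable_aff (phi i K) measurableT.
  move=> /(_ (~` [set 0])); rewrite setTI; apply.
  by apply: measurableC; exact: measurable_set1.
have -> : (\sum_(K \in [set` r]) mu2 (otri K) = \sum_(K \in [set` r]) mu2 (F K))%E.
  by apply: eq_fsbigr => K; rewrite inE /= rE => Ki; rewrite mu2_phi_neq0.
have tF : trivIset [set` r] F.
  apply/trivIsetP => K L _ _ KL; rewrite -subset0 => x [[xK _] [xL _]].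
  by have : (otri K `&` otri L) x by []; rewrite otri_disjoint.
have <- : mu2 (\bigcup_(K in [set` r]) F K) = (\sum_(K \in [set` r]) mu2 (F K))%E.
  by apply: measure_fin_bigcup => // K _; exact: mF.
apply: le_measure; rewrite ?inE //.
  by apply: fin_bigcup_measurable => // K _; exact: mF.
move=> x [K _ [xK h]]; apply: subset_closure => /=.
by rewrite (broken_fun_otri _ xK).
Qed.

(** Both sides are a third of the area of the triangles having the edge i. *)
Lemma mass_entry_int i : 3^-1 * fine (mu2 (CR_support (phi i))) =
  (\int[@mu2 R]_(x in Omega) broken_fun (phi i) x)%R.
Proof.
rewrite mu2_support int_broken -sum_fine; last first.
  by move=> K _; rewrite ge0_fin_numE ?measure_ge0 // area_lty.
rewrite mulr_sumr big_mkcond /=; apply: eq_bigr => K _.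
by rewrite int_phi; case: ifP => _; rewrite ?mulr1 ?mulr0.
Qed.

Lemma mass_entry_gt0 i : 0 < 3^-1 * fine (mu2 (CR_support (phi i))).
Proof.
rewrite mass_entry_int int_broken.
under eq_bigr do rewrite int_phi.
have [K [k ik]] := edge_side (t:=T) i.
have Ki : has_edge K i by apply/existsP; exists k; exact/asboolP.
have pos (a : 'I_(ntri T) -> R) : (forall L, 0 < a L) ->
    0 < \sum_L 3^-1 * a L * (has_edge L i)%:R.
  move=> a0; rewrite (bigD1 K) //= Ki mulr1 ltr_pwDl ?mulr_gt0 ?invr_gt0 //.
  by apply: sumr_ge0 => L _; rewrite !mulr_ge0 ?invr_ge0 // ltW.
by apply: pos; exact: area_gt0.
Qed.

End Mesh.

(** * Normals and traces *)

Section Normals.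
Variable R : realType.
Implicit Types (q : R * (R * R)) (x n d : R * R) (s e : R).

Lemma enorm_gt0 d : d != 0 -> 0 < enorm d.
Proof. by move=> d0; rewrite sqrtr_gt0 dot_gt0. Qed.

Lemma enorm_sqr d : enorm d ^+ 2 = dot d d.
Proof. by rewrite sqr_sqrtr // /dot -!expr2 addr_ge0 ?sqr_ge0. Qed.

(** Both vectors are multiples of the vector d turned by a right angle, with
    coefficients of equal square. *)
Lemma unit_normal_eq d n n' : d != 0 -> enorm n = 1 -> enorm n' = 1 ->
  dot n d = 0 -> dot n' d = 0 -> n = n' \/ n = - n'.
Proof.
move=> d0 n1 n1' nd nd'.
have dd := dot_gt0 d0.
pose a m := (m.1 * d.2 - m.2 * d.1) / dot d d.
have aE m : dot m d = 0 -> m = a m *: ((d.2, - d.1) : R * R).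
  move=> md; apply: pair_ext; rewrite /= /GRing.scale /= /a;
    apply: (mulIf (lt0r_neq0 dd)); rewrite mulrAC divfK ?lt0r_neq0 //;
    move: md; rewrite /dot => md.
    have -> : m.1 * (d.1 * d.1 + d.2 * d.2) = m.1 * d.1 * d.1 + m.1 * d.2 * d.2 by ring.
    have -> : m.1 * d.1 = - (m.2 * d.2) by lra.
    by ring.
  have -> : m.2 * (d.1 * d.1 + d.2 * d.2) = m.2 * d.2 * d.2 + m.2 * d.1 * d.1 by ring.
  have -> : m.2 * d.2 = - (m.1 * d.1) by lra.
  by ring.
have a2 m : dot m d = 0 -> enorm m = 1 -> a m ^+ 2 * dot d d = 1.
  move=> md m1; rewrite -[RHS](expr1n _ 2) -m1 enorm_sqr {2 3}(aE m md).
  by rewrite /dot /= /GRing.scale /=; ring.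
have : a n ^+ 2 == a n' ^+ 2.
  by rewrite -(inj_eq (mulIf (lt0r_neq0 dd))) !a2.
rewrite eqf_sqr => /orP[/eqP an|/eqP an]; [left|right].
  by rewrite (aE n nd) an -(aE n' nd').
by rewrite (aE n nd) an scaleNr -(aE n' nd').
Qed.

Variable p : 'I_3 -> R * R.
Hypothesis p0 : orient p != 0.

Let dir k := (side p k).2 - (side p k).1.

Lemma side_dir_neq0 k : dir k != 0.
Proof.
apply/eqP => /subr0_eq h; have := bary_vtx p0 (k + 1) (k + 1).
have := bary_vtx p0 (k + 1) (k + 2).
move: h; rewrite /side /= => -> ->; rewrite eqxx.
by move: k; apply: ord3_ind; rewrite !ord3_addE /= => /eqP; rewrite eq_sym oner_eq0.
Qed.

Lemma outnormalE k : outnormal p k =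
  (Num.sg (orient p) / enorm (dir k)) *: (((dir k).2, - (dir k).1) : R * R).
Proof. by []. Qed.

Lemma outnormal_unit k : enorm (outnormal p k) = 1.
Proof.
have d0 := side_dir_neq0 k.
rewrite outnormalE; set c := _ / _; rewrite /enorm.
have -> : dot (c *: (((dir k).2, - (dir k).1) : R * R))
    (c *: (((dir k).2, - (dir k).1) : R * R)) = c ^+ 2 * dot (dir k) (dir k).
  by rewrite /dot /= /GRing.scale /=; ring.
rewrite -enorm_sqr -exprMn divfK ?gt_eqF ?enorm_gt0 //.
by rewrite sqr_sg p0 sqrtr1.
Qed.

Lemma outnormal_perp k : dot (outnormal p k) (dir k) = 0.
Proof. by rewrite outnormalE /dot /= /GRing.scale /=; ring. Qed.

(** The outward normal points to where the coordinate of its side is negative. *)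
Lemma bary_outnormal k : dot (bary p k).2 (outnormal p k) < 0.
Proof.
have d0 := side_dir_neq0 k.
rewrite outnormalE.
have -> : dot (bary p k).2
    ((Num.sg (orient p) / enorm (dir k)) *: (((dir k).2, - (dir k).1) : R * R)) =
  - (Num.sg (orient p) / orient p) * (dot (dir k) (dir k) / enorm (dir k)).
  have e0 : enorm (dir k) != 0 by rewrite gt_eqF ?enorm_gt0.
  rewrite /bary -/(dir k) /= /dot /= /GRing.scale /=; field.
  by rewrite p0 e0.
have sg0 : 0 < Num.sg (orient p) / orient p; last first.
  by rewrite mulNr oppr_lt0 (mulr_gt0 sg0) // divr_gt0 ?dot_gt0 ?enorm_gt0.
have [h|h|h] := ltrgt0P (orient p).
- by rewrite gtr0_sg // mul1r invr_gt0.
- by rewrite ltr0_sg // mulN1r oppr_gt0 invr_lt0.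
- by move: p0; rewrite h eqxx.
Qed.

(** At an inner point of a side the coordinate of this side vanishes and
    increases inwards, while the two others are positive. *)
Lemma near_itriangle k s : 0 < s < 1 ->
  \forall e \near (0:R)^'+,
    (triangle p)° (edge_pt (side p k) s - e *: outnormal p k).
Proof.
move=> /andP[s0 s1]; have [b0 b1 b2] := bary_side p0 k s.
set x := edge_pt _ _ in b0 b1 b2 *; set n := outnormal p k.
have nb j : 0 < aff (bary p j) x ->
    \forall e \near (0:R)^'+, 0 < aff (bary p j) (x - e *: n).
  move=> h; pose A := [set y | 0 < aff (bary p j) y].
  have Ax : nbhs x A by apply: open_nbhs_nbhs; split; [exact: aff_gt0_open | exact: h].
  have : \forall e \near (0:R)^'+, A (x - e *: n) by exact: cvg_line Ax.
  exact.
have n1 : \forall e \near (0:R)^'+, 0 < aff (bary p (k + 1)) (x - e *: n).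
  by apply: nb; rewrite b1 subr_gt0.
have n2 : \forall e \near (0:R)^'+, 0 < aff (bary p (k + 2)) (x - e *: n).
  by apply: nb; rewrite b2.
near=> e; apply: (bary_gt0_interior p0); 
  apply: (@ord3_cyc_ind k (fun j => 0 < aff (bary p j) (x - e *: n))).
- rewrite aff_move b0 sub0r oppr_gt0 pmulr_rlt0 ?bary_outnormal //.
- by near: e.
- by near: e.
Unshelve. all: by end_near. Qed.

Lemma trace_near (V : normedModType R) (f g : R * R -> V) x n :
  (\forall e \near (0:R)^'+, f (x - e *: n) = g (x - e *: n)) ->
  {for x, continuous g} -> trace f x n = g x.
Proof.
move=> fg gc; apply: cvg_lim => //.
apply: (@cvg_trans _ (g (x - e *: n) @[e --> (0:R)^'+])).
  by apply: near_eq_cvg; near=> e; apply/esym; near: e.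
by apply: continuous_cvg => //; exact: cvg_line.
Unshelve. all: by end_near. Qed.

End Normals.

(** * Functions bounded almost everywhere on the unit interval *)

Section ReflectNull.
Variable R : realType.
Notation lam := (@lebesgue_measure R).

Lemma ae_imp (P Q : R -> Prop) : (forall s, P s -> Q s) ->
  {ae lam, forall s, P s} -> {ae lam, forall s, Q s}.
Proof. by move=> PQ; apply: negligibleS => s /= nQ /PQ. Qed.

Lemma ae_and (P Q : R -> Prop) : {ae lam, forall s, P s} ->
  {ae lam, forall s, Q s} -> {ae lam, forall s, P s /\ Q s}.
Proof.
move=> aP aQ; apply: negligibleS (negligibleU aP aQ) => s /=.
by rewrite -not_andP.
Qed.

Lemma ae_neq (r : R) : {ae lam, forall s, s != r}.
Proof.
exists [set r]; split => //; first exact: lebesgue_measure_set1.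
by move=> s /= /negP/negPn/eqP.
Qed.

(** The two triangles sharing an edge may parametrize it in opposite
    directions. *)
Lemma ae_reflect (P : R -> Prop) :
  {ae lam, forall s, P s} -> {ae lam, forall s, P (1 - s)}.
Proof.
move=> [N [mN N0 PN]]; exists ((fun s => 1 - s) @^-1` N); split.
- rewrite -[X in measurable X]setTI.
  have : measurable_fun setT (fun s : R => 1 - s) by exact: measurable_funB.
  by apply.
- rewrite -N0 -(lebesgue_measureD 1 mN).
  rewrite -[RHS]lebesgue_measureN /pushforward //; last first.
    rewrite -[X in measurable X]setTI.
    have : measurable_fun setT (fun s : R => s + 1) by exact: measurable_funD.
    by apply.
  by congr (lam _); apply/seteqP; split => s /=; rewrite addrC.
- by move=> s h; apply: PN.
Qed.

Lemma integrable_ae_bounded (D : set R) (f : R -> R) (C : R) :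
  measurable D -> D `<=` `[0, 1]%classic -> measurable_fun D f ->
  {ae lam, forall s, D s -> `|f s| <= C} -> lam.-integrable D (EFin \o f).
Proof.
move=> mD D01 mf fC; apply/integrableP; split; first exact/measurable_EFinP.
have Dfin : (lam D < +oo)%E.
  apply: (@le_lt_trans _ _ (lam `[0, 1]%classic)).
    by apply: le_measure; rewrite ?inE.
  by rewrite lebesgue_measure_itv /=; case: ifP => _; rewrite ?ltry // -EFinD ltry.
apply: le_lt_trans.
  apply: (integral_le_bound (`|C|)%:E) => //; first exact/measurable_EFinP.
  by apply: ae_imp fC => s h Ds; rewrite lee_fin (le_trans (h Ds)) // ler_norm.
by rewrite lte_mul_pinfty.
Qed.

End ReflectNull.

(** * Traces on the edges of the mesh *)

Section Traces.
Variables (R : realType) (Omega : set (R * R)) (T : triangulation Omega).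
Hypothesis pdO : polygonal_domain Omega.
Implicit Types (q : R * (R * R)) (x n : R * R) (K L : 'I_(ntri T)) (v : broken T).
Implicit Types (k l : 'I_3) (s : R) (e : (R * R) * (R * R)).
Notation lam := (@lebesgue_measure R).

Lemma same_edge_interior_pt e e' s : same_edge e e' -> 0 < s < 1 ->
  exists2 s', 0 < s' < 1 & edge_pt e s = edge_pt e' s'.
Proof.
move=> /(same_edge_pt s)[->|->] h; first by exists s.
by exists (1 - s) => //; move: h => /andP[? ?]; apply/andP; split; lra.
Qed.

Lemma near_otri e K k s : same_edge e (side (vtx K) k) -> 0 < s < 1 ->
  \forall t \near (0:R)^'+, otri K (edge_pt e s - t *: outnormal (vtx K) k).
Proof.
move=> ek /(same_edge_interior_pt ek)[s' s'01 ->].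
by apply: near_itriangle => //; exact: tri_nondegenerate.
Qed.

Lemma trace_broken e v K k s : same_edge e (side (vtx K) k) -> 0 < s < 1 ->
  trace (broken_fun v) (edge_pt e s) (outnormal (vtx K) k) =
  aff (v K) (edge_pt e s).
Proof.
move=> ek s01; apply: trace_near; last exact: continuous_aff.
near=> t; apply: broken_fun_otri; near: t; exact: near_otri.
Unshelve. all: by end_near. Qed.

Lemma perp_same_edge n e e' : same_edge e e' ->
  dot n (e.2 - e.1) = 0 -> dot n (e'.2 - e'.1) = 0.
Proof.
move=> [->//|->] /= h; rewrite -[RHS]oppr0 -h /dot /=; ring.
Qed.

(** Otherwise the normals would be equal, and moving from the common midpoint
    against them would lead into both open triangles, which are disjoint. *)
Lemma outnormal_opp K L k l : K != L ->
  same_edge (side (vtx K) k) (side (vtx L) l) ->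
  outnormal (vtx L) l = - outnormal (vtx K) k.
Proof.
move=> KL kl.
have K0 := tri_nondegenerate (t:=T) K; have L0 := tri_nondegenerate (t:=T) L.
have [eqn|//] := unit_normal_eq (side_dir_neq0 K0 k) (outnormal_unit L0 l)
  (outnormal_unit K0 k) (perp_same_edge (same_edge_sym kl) (outnormal_perp _ l))
  (outnormal_perp _ k).
have h01 : 0 < (2^-1 : R) < 1 by lra.
have nK := near_otri (or_introl erefl : same_edge (side (vtx K) k) (side (vtx K) k)) h01.
have nL := near_otri kl h01.
rewrite eqn in nL.
have [t [tK tL]] := filter_ex (filterI (F := nbhs (0:R)^'+) nK nL).
move: (edge_pt _ _ - _) tK tL => x tK tL.
by have : (otri K `&` otri L) x by []; rewrite otri_disjoint.
Qed.

Lemma nF_outnormal i K k : same_edge (edge (t:=T) i) (side (vtx K) k) ->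
  nF (t:=T) i = outnormal (vtx K) k \/ nF (t:=T) i = - outnormal (vtx K) k.
Proof.
move=> ik; have K0 := tri_nondegenerate (t:=T) K.
apply: (unit_normal_eq (side_dir_neq0 K0 k)).
- exact: nF_unit.
- exact: outnormal_unit.
- exact: perp_same_edge ik (nF_normal i).
- exact: outnormal_perp.
Qed.

(** The minus side of an interior edge is the triangle K whose outward normal is
    the normal of the edge, the plus side is L. *)
Lemma interior_edge_sides i : interior_edge (T:=T) i -> exists K L k l,
  [/\ same_edge (edge (t:=T) i) (side (vtx K) k),
      same_edge (edge (t:=T) i) (side (vtx L) l),
      nF (t:=T) i = outnormal (vtx K) k & - nF (t:=T) i = outnormal (vtx L) l].
Proof.
move=> [K [L [k [l [KL ik il]]]]].
have nn := outnormal_opp KL (same_edge_trans (same_edge_sym ik) il).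
have [nk|nk] := nF_outnormal ik; first by exists K, L, k, l; rewrite nn nk.
by exists L, K, l, k; rewrite nn nk opprK.
Qed.

Lemma coord_le_enorm x : `|x.1| <= enorm x /\ `|x.2| <= enorm x.
Proof.
by rewrite -!sqrtr_sqr /enorm /dot -!expr2; split; apply: ler_wsqrtr;
  rewrite ?lerDl ?lerDr sqr_ge0.
Qed.

Lemma dot_le_enorm x n : `|dot x n| <= 2 * enorm x * enorm n.
Proof.
have [x1 x2] := coord_le_enorm x; have [n1 n2] := coord_le_enorm n.
apply: le_trans (ler_normD _ _) _; rewrite !normrM.
have := ler_pM (normr_ge0 _) (normr_ge0 _) x1 n1.
have := ler_pM (normr_ge0 _) (normr_ge0 _) x2 n2.
lra.
Qed.

Variable beta : R * R -> R * R.
Hypothesis beta_reg : regular_velocity T beta.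

Definition flux e n s := dot (trace beta (edge_pt e s) n) n.

(** The traces are limits of values of beta inside the triangles, and these
    values are bounded.  The end points of the edge have to be left out: from
    there the normal direction may lead out of the triangle. *)
Lemma flux_bound : exists C : R, forall K k e, same_edge e (side (vtx K) k) ->
  {ae lam, forall s, s \in `[0, 1] -> `|flux e (outnormal (vtx K) k) s| <= C}.
Proof.
have [C betaC] := rv_bounded beta_reg.
exists (2 * C) => K k e ek.
have K0 := tri_nondegenerate (t:=T) K.
set n := outnormal _ _.
have {}tr : {ae lam, forall s, s \in `[0, 1] -> has_trace beta (edge_pt e s) n}.
  have h := rv_trace beta_reg K k.
  case: ek => [->//|->]; apply: ae_imp (ae_reflect h) => s hs.
  by rewrite edge_pt_rev /= !in_itv /= => ?; apply: hs; rewrite in_itv /=; lra.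
apply: ae_imp (ae_and tr (ae_and (ae_neq 0) (ae_neq 1))) => s [trs [s0 s1]] s01.
have {}s01 : 0 < s < 1.
  by move: s01; rewrite in_itv /= !lt_neqAle s1 eq_sym s0.
have {}trs : has_trace beta (edge_pt e s) n.
  by apply: trs; rewrite in_itv /=; move: s01 => /andP[? ?]; rewrite !ltW.
have dcont (m : R * R) : {for m, continuous (fun y => dot y n)}.
  rewrite /dot; apply: cvgD; apply: cvgM; try exact: cvg_cst; [exact: cvg_fst|exact: cvg_snd].
have lim_flux : dot (beta (edge_pt e s - t *: n)) n @[t --> (0:R)^'+] --> flux e n s.
  exact: (cvg_comp _ (fun y => dot y n) trs (dcont _)).
apply: (@closed_cvg _ _ (at_right 0) _
  (fun t => dot (beta (edge_pt e s - t *: n)) n) (fun y => `|y| <= 2 * C)).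
- apply: (@closed_comp R R Num.norm [set y | y <= 2 * C]); last exact: closed_le.
  by move=> y _; exact: (@norm_continuous R R).
- near=> t; apply: le_trans (dot_le_enorm _ _) _.
  rewrite outnormal_unit // mulr1 ler_wpM2l //; apply: betaC.
  apply: (otri_sub pdO); near: t; exact: near_otri.
- exact: lim_flux.
Unshelve. all: by end_near. Qed.

Lemma measurable_flux e K k : same_edge e (side (vtx K) k) ->
  measurable_fun (`[0, 1]%classic : set R) (flux e (outnormal (vtx K) k)).
Proof.
move=> ek; set n := outnormal _ _.
have mt : measurable_fun (`[0, 1]%classic : set R)
    (fun s => trace beta (edge_pt e s) n).
  have h := rv_trace_measurable beta_reg K k.
  case: ek => [->//|->].
  have -> : (fun s => trace beta (edge_pt ((side (vtx K) k).2, (side (vtx K) k).1) s) n) =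
     (fun s => trace beta (edge_pt (side (vtx K) k) s) n) \o (fun s => 1 - s).
    by apply/funext => s; rewrite edge_pt_rev.
  apply: (measurable_comp _ _ h); first exact: measurable_itv.
  - move=> s [s' /=]; rewrite in_itv /= => s01 <-; rewrite in_itv /=; lra.
  - exact: measurable_funB.
rewrite /flux /dot; apply: measurable_funD; apply: measurable_funM => //.
- exact: measurableT_comp measurable_fst mt.
- exact: measurableT_comp measurable_snd mt.
Qed.

End Traces.

(** * Column sums of the stiffness matrix and conservation *)

Section Integrals.
Variables (R : realType) (Omega : set (R * R)) (T : triangulation Omega).
Hypothesis pdO : polygonal_domain Omega.
Implicit Types (q : R * (R * R)) (x n : R * R) (K L : 'I_(ntri T)) (v : broken T).
Implicit Types (k l : 'I_3) (s : R) (e : (R * R) * (R * R)).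
Notation lam := (@lebesgue_measure R).

Lemma measurable_edge_pt e : measurable_fun setT (edge_pt e).
Proof.
by apply: measurable_fun_pair; apply: measurable_funD; apply: measurable_funM => //;
  apply: measurable_funB.
Qed.

Lemma measurable_aff_edge q e (D : set R) :
  measurable_fun D (fun s => aff q (edge_pt e s)).
Proof.
apply: measurable_funTS.
by apply: measurableT_comp (measurable_aff q) (measurable_edge_pt e).
Qed.

Lemma aff_edge_bound q e s : s \in `[0, 1] ->
  `|aff q (edge_pt e s)| <= `|aff q e.1| + `|aff q e.2|.
Proof.
rewrite in_itv /= => /andP[s0 s1]; rewrite aff_edge_pt.
apply: le_trans (ler_normD _ _) _; rewrite !normrM (ger0_norm s0) ger0_norm ?subr_ge0 //.
by apply: lerD; rewrite ler_piMl // lerBlDl lerDr.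
Qed.

(** The form of all integrands on edges: f is a normal trace of beta or its
    positive or negative part, q and q' are a trial and a test function. *)
Lemma integrable_edge (D : set R) (f : R -> R) C e q q' :
  measurable D -> D `<=` `[0, 1]%classic -> measurable_fun (`[0, 1]%classic : set R) f ->
  {ae lam, forall s, s \in `[0, 1] -> `|f s| <= C} ->
  lam.-integrable D (EFin \o (fun s => f s * aff q (edge_pt e s) * aff q' (edge_pt e s))).
Proof.
move=> mD D01 mf fC.
apply: (integrable_ae_bounded
  (C := C * (`|aff q e.1| + `|aff q e.2|) * (`|aff q' e.1| + `|aff q' e.2|))) => //.
  apply: measurable_funM; last exact: measurable_aff_edge.
  apply: measurable_funM; last exact: measurable_aff_edge.
  exact: measurable_funS mf.
apply: ae_imp fC => s fs /D01 s01; rewrite !normrM.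
by rewrite !ler_pM ?mulr_ge0 ?normr_ge0 // ?fs ?aff_edge_bound.
Qed.

Lemma affB q q' x : aff (q - q') x = aff q x - aff q' x.
Proof. by rewrite /aff /dot /=; ring. Qed.

Lemma measurable_off_frontier e :
  measurable [set s : R | s \in `[0, 1] /\ (~` frontier Omega) (edge_pt e s)].
Proof.
have mfr : measurable (frontier Omega).
  apply: measurableD; last first.
    by apply: open_measurable_plane; exact: open_interior.
  by apply: closed_measurable_plane; exact: closed_closure.
have -> : [set s : R | s \in `[0, 1] /\ (~` frontier Omega) (edge_pt e s)] =
  `[0, 1]%classic `&` (edge_pt e @^-1` (~` frontier Omega)) by [].
apply: measurableI => //; rewrite -[X in measurable X]setTI.
by apply: (measurable_edge_pt e) => //; exact: measurableC.
Qed.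

Lemma on_edge_setT e :
  [set s : R | s \in `[0, 1] /\ [set: R * R] (edge_pt e s)] = `[0, 1]%classic.
Proof. by apply/seteqP; split => [s []|s]. Qed.

Variables (phi : 'I_(nedge T) -> broken T) (beta : R * R -> R * R).
Hypothesis phiB : CR_basis phi.
Hypothesis beta_reg : regular_velocity T beta.

Lemma sum_edge_int K k (u : broken T) :
  let e := side (vtx K) k in let n := outnormal (vtx K) k in
  \sum_i edge_int (~` frontier Omega) e
    (fun x => dot (trace beta x n) n * aff (u K) x * aff (phi i K) x) =
  edge_int (~` frontier Omega) e (fun x => dot (trace beta x n) n * aff (u K) x).
Proof.
move=> e n; have [C fC] := flux_bound pdO beta_reg.
have ee : same_edge e (side (vtx K) k) by left.
rewrite /edge_int -mulr_sumr; congr (_ * _).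
rewrite -Rintegral_sum.
- apply: eq_Rintegral => s _.
  by rewrite -mulr_sumr (sum_phi phiB) mulr1.
- exact: measurable_off_frontier.
- move=> i _; apply: (integrable_edge (f := flux beta e n) (C := C)).
  + exact: measurable_off_frontier.
  + by move=> s [].
  + exact: (measurable_flux beta_reg ee).
  + exact: (fC _ _ _ ee).
Qed.

Hypothesis beta_imp : impermeable T beta.

(** The normal trace of beta vanishes on the part added. *)
Lemma edge_int_impermeable K k (u : broken T) :
  let e := side (vtx K) k in let n := outnormal (vtx K) k in
  edge_int (~` frontier Omega) e (fun x => dot (trace beta x n) n * aff (u K) x) =
  edge_int setT e (fun x => dot (trace beta x n) n * aff (u K) x).
Proof.
move=> e n; have [C fC] := flux_bound pdO beta_reg.
have ee : same_edge e (side (vtx K) k) by left.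
rewrite /edge_int; congr (_ * _); rewrite on_edge_setT.
set A := [set s | _]; have mA : measurable A by exact: measurable_off_frontier.
have A01 : A `<=` `[0, 1]%classic by move=> s [].
pose f s := dot (trace beta (edge_pt e s) n) n * aff (u K) (edge_pt e s).
have mf : measurable_fun (`[0, 1]%classic : set R) f.
  apply: measurable_funM; last exact: measurable_aff_edge.
  exact: (measurable_flux beta_reg ee).
transitivity (\int[lam]_(s in `[0, 1]%classic) (f \_ A) s)%R.
  by rewrite -Rintegral_mkcondr setIidr.
rewrite /Rintegral; congr fine; apply: ae_eq_integral => //.
- apply/measurable_EFinP; apply/(measurable_restrict _ mA) => //.
  rewrite setIidr //; exact: measurable_funS mf.
- exact/measurable_EFinP.
- have h := beta_imp K k; apply: ae_imp h => s h s01.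
  rewrite patchE; case: ifPn => // sA; rewrite /f.
  rewrite h ?mul0r //; apply: contrapT => sF; move/negP: sA; apply.
  by rewrite inE; split.
Qed.

(** The numerical flux is integrated against the jumps of the test functions,
    and these sum to the jump of the constant 1. *)
Lemma sum_upwind_eq0 i (u : broken T) : interior_edge (T:=T) i ->
  \sum_m edge_int setT (edge (t:=T) i) (fun x =>
    upwind beta u (nF (t:=T) i) x * (- jump (phi m) (nF (t:=T) i) x)) = 0.
Proof.
move=> /interior_edge_sides[K [L [k [l [ik il nk nl]]]]].
have [C fC] := flux_bound pdO beta_reg.
set e := edge i in ik il *; set n := nF i in nk nl *.
have fCe := fC K k e ik; have mfe := measurable_flux beta_reg ik.
rewrite -nk in fCe mfe.
(* K is the minus side and L the plus side of the edge; on its interior the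
   integrand for the m-th test function is G m. *)
pose fp s := Num.max 0 (flux beta e n s); pose fm s := Num.min 0 (flux beta e n s).
pose G1 m s := fp s * aff (u K) (edge_pt e s) * aff (phi m K - phi m L) (edge_pt e s).
pose G2 m s := fm s * aff (u L) (edge_pt e s) * aff (phi m K - phi m L) (edge_pt e s).
pose G m s := G1 m s + G2 m s.
have GE m s : s \in `]0, 1[ ->
    upwind beta u n (edge_pt e s) * (- jump (phi m) n (edge_pt e s)) = G m s.
  rewrite in_itv /= => s01; rewrite /upwind /jump nl nk.
  rewrite !(trace_broken _ ik s01) !(trace_broken _ il s01).
  rewrite /G /G1 /G2 /fp /fm /flux nk !affB; ring.
have int01 (f : R -> R) q q' : measurable_fun (`[0, 1]%classic : set R) f ->
   (forall s, `|f s| <= `|flux beta e n s|) ->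
   lam.-integrable (`]0, 1[%classic : set R)
     (EFin \o (fun s => f s * aff q (edge_pt e s) * aff q' (edge_pt e s))).
  move=> mf ff; apply: (integrable_edge (C := C)) => //.
    by apply: subset_itv; rewrite bnd_simp.
  by apply: ae_imp fCe => s h /h; apply: le_trans.
have iG m : lam.-integrable (`]0, 1[%classic : set R) (EFin \o G m).
  have i1 : lam.-integrable (`]0, 1[%classic : set R) (EFin \o G1 m).
    apply: int01; first exact: measurable_maxr.
    by move=> s; rewrite /fp; case: (lerP 0 (flux beta e n s)) => h; rewrite ?normr0.
  have i2 : lam.-integrable (`]0, 1[%classic : set R) (EFin \o G2 m).
    apply: int01; first exact: measurable_minr.
    by move=> s; rewrite /fm; case: (lerP 0 (flux beta e n s)) => h; rewrite ?normr0.
  exact: integrableD i1 i2.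
(* The traces of the broken functions are known at the inner points only. *)
have oc (f : R -> R) : lam.-integrable (`]0, 1[%classic : set R) (EFin \o f) ->
   (\int[lam]_(s in `[0, 1]%classic) f s)%R = (\int[lam]_(s in `]0%R, 1%R[%classic) f s)%R.
  by move=> /measurable_int mf; rewrite /Rintegral integral_itv_bndoo.
rewrite /edge_int -mulr_sumr on_edge_setT.
transitivity (enorm (e.2 - e.1) * \sum_m (\int[lam]_(s in `]0%R, 1%R[%classic) G m s)%R).
  congr (_ * _); apply: eq_bigr => m _; rewrite oc.
    by apply: eq_Rintegral => s; rewrite inE => s01; exact: GE.
  apply: eq_integrable (iG m) => // s; rewrite inE => s01.
  by rewrite /= -GE.
rewrite -Rintegral_sum // (_ : (\int[lam]_(s in _) _)%R = 0) ?mulr0 //.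
rewrite /Rintegral integral0_eq // => s _; congr (_%:E).
rewrite /G /G1 /G2 big_split /= -!mulr_sumr.
have -> : \sum_i0 aff (phi i0 K - phi i0 L) (edge_pt e s) = 0.
  under eq_bigr do rewrite affB.
  by rewrite sumrB !(sum_phi phiB) subrr.
by rewrite !mulr0 addr0.
Qed.

Hypothesis beta_div : divergence_free T beta.

(** The test functions sum to 1; then the divergence theorem applies with a
    vanishing divergence. *)
Lemma sum_a_h (u : broken T) :
  \sum_i a_h beta u (phi i) =
  \sum_K bnd_int setT K (fun x n => dot (trace beta x n) n * aff (u K) x).
Proof.
have [C betaC] := rv_bounded beta_reg.
rewrite /a_h exchange_big /=; apply: eq_bigr => K _.
have K0 := tri_nondegenerate (t:=T) K.
have mK := measurable_otri K.
have mb : measurable_fun (otri K) (fun x => dot (beta x) (u K).2).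
  have mO : measurable_fun (otri K) beta.
    apply: measurable_funS (rv_measurable beta_reg); last exact: otri_sub.
    exact: measurable_Omega pdO.
  rewrite /dot; apply: measurable_funD; apply: measurable_funM => //.
  - exact: measurableT_comp measurable_fst mO.
  - exact: measurableT_comp measurable_snd mO.
rewrite -Rintegral_sum //; last first.
  move=> i _; have [M hM] := aff_bounded (vtx K) (phi i K).
  apply: (integrable_bounded (p := vtx K) (C := 2 * C * enorm (u K).2 * M)) => //.
    by apply: measurable_funM => //; apply: measurable_funTS; exact: measurable_aff.
  move=> x xK; rewrite normrM; apply: ler_pM => //.
    apply: le_trans (dot_le_enorm _ _) _; rewrite ler_wpM2r ?sqrtr_ge0 //.
    by rewrite ler_wpM2l // betaC //; exact: (otri_sub pdO xK).
  by apply: hM; exact: interior_subset.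
rewrite -(rv_divergence beta_reg _ (@beta_div K) (u K)); last exact: integrable0.
by apply: eq_Rintegral => x _; rewrite -mulr_sumr (sum_phi phiB) mulr1 mul0r addr0.
Qed.

(** Only the boundary terms of the triangles remain, completed to the whole
    boundary of each triangle by impermeability. *)
Lemma sum_b_h (u : broken T) :
  \sum_i b_h beta u (phi i) =
  \sum_K bnd_int setT K (fun x n => dot (trace beta x n) n * aff (u K) x).
Proof.
rewrite /b_h big_split /= sumrN [X in _ - X]exchange_big /=.
rewrite [X in _ - X]big1 ?subr0; last first.
  by move=> i /asboolP ii; exact: sum_upwind_eq0.
rewrite exchange_big /=; apply: eq_bigr => K _.
rewrite /bnd_int exchange_big /=; apply: eq_bigr => k _.
by rewrite sum_edge_int edge_int_impermeable.
Qed.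

Lemma stiffness_colsum j : \sum_i stiffness beta phi i j = 0.
Proof.
under eq_bigr do rewrite mxE.
by rewrite sumrB sum_a_h sum_b_h subrr.
Qed.

Definition total_mass (U : 'cV[R]_(nedge T)) : R :=
  (\int[@mu2 R]_(x in Omega) (\sum_i U i 0 * broken_fun (phi i) x))%R.

Lemma integrable_broken v : (@mu2 R).-integrable Omega (EFin \o broken_fun v).
Proof.
rewrite /broken_fun; apply: integrable_rsum; first exact: measurable_Omega pdO.
by move=> K _; exact: integrable_otri.
Qed.

Lemma total_massE U : total_mass U = \sum_i mass phi i i * U i 0.
Proof.
have mO := measurable_Omega pdO.
rewrite /total_mass Rintegral_sum //; last first.
  move=> i _.
  have -> : EFin \o (fun x => U i 0 * broken_fun (phi i) x) =
     (fun x => (U i 0)%:E * (EFin \o broken_fun (phi i)) x)%E.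
    by apply/funext => x /=; rewrite EFinM.
  by apply: integrableZl => //; exact: integrable_broken.
apply: eq_bigr => i _; rewrite RintegralZl //; last exact: integrable_broken.
by rewrite -mass_entry_int // /mass !mxE eqxx mulr1n mulrC.
Qed.

Lemma mass_unit : mass phi \in unitmx.
Proof.
rewrite unitmxE det_diag unitfE; apply/prodf_neq0 => i _.
by rewrite mxE gt_eqF // mass_entry_gt0.
Qed.

(** Summing the entries of M U - dt S U: the second part is the pairing of U
    with the column sums of S. *)
Lemma total_mass_step (dt : R) (U : 'cV[R]_(nedge T)) :
  total_mass ((1%:M - dt *: (invmx (mass phi) *m stiffness beta phi)) *m U) = total_mass U.
Proof.
have totalM V : total_mass V = \sum_i (mass phi *m V) i 0.
  rewrite total_massE; apply: eq_bigr => i _; rewrite [RHS]mxE (bigD1 i) //= big1 ?addr0 //.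
  by move=> j ji; rewrite /mass !mxE (negPf (_ : i != j)) 1?eq_sym // mulr0n mul0r.
rewrite !totalM mulmxA mulmxBr mulmx1 -scalemxAr mulKVmx ?mass_unit //.
rewrite mulmxBl -scalemxAl.
transitivity (\sum_i ((mass phi *m U) i 0 - dt * (stiffness beta phi *m U) i 0)).
  by apply: eq_bigr => i _; rewrite !mxE.
rewrite sumrB -mulr_sumr.
suff -> : \sum_i (stiffness beta phi *m U) i 0 = 0 by rewrite mulr0 subr0.
under eq_bigr do rewrite mxE.
rewrite exchange_big big1 //= => j _.
by rewrite -mulr_suml stiffness_colsum mul0r.
Qed.

End Integrals.

Theorem theorem4p1 (R : realType) (Omega : set (R * R))
  (T : triangulation Omega)
  (phi : 'I_(nedge T) -> broken T)
  (beta : R -> R * R -> R * R)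
  (t : nat -> R)
  (U : nat -> 'cV[R]_(nedge T)) :
  polygonal_domain Omega ->
  CR_basis phi ->
  (forall n, t n < t n.+1) ->
  (forall n, regular_velocity T (beta (t n))) ->
  (forall n, impermeable T (beta (t n))) ->
  (forall n, divergence_free T (beta (t n))) ->
  (forall n, normal_continuous T (beta (t n))) ->
  (forall n, U n.+1 =
     (1%:M - (t n.+1 - t n) *:
        (invmx (mass phi) *m stiffness (beta (t n)) phi)) *m U n) ->
  let u n x := \sum_i U n i 0 * broken_fun (phi i) x in
  forall n,
    (\int[@mu2 R]_(x in Omega) u n x)%R = (\int[@mu2 R]_(x in Omega) u 0%N x)%R.
Proof.
move=> pdO phiB _ reg imp dfree _ step u.
elim=> [//|n <-].
change (total_mass phi (U n.+1) = total_mass phi (U n)).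
by rewrite step; exact: total_mass_step.
Qed.
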